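(* Let $G$ be a discrete group. Then $G$ is amenable if and only if for every unitary representation $\pi$ of $G$ in an infinite-dimensional Hilbert space $\mathcal{H}_\pi$, the pair $(\mathbb{S}_\pi, G)$ has the concentration property, where $\mathbb{S}_\pi$ is the unit sphere of $\mathcal{H}_\pi$, equipped with the uniformity of the norm distance, and $G$ acts on $\mathbb{S}_\pi$ via $\pi$.
   Context: Hilbert spaces are complex. Let $X=(X,\mathcal{U}_X)$ be a uniform space and let a group $G$ act on $X$ by uniform isomorphisms. For $A\subseteq X$ and $V\in\mathcal{U}_X$, $V[A]$ denotes the $V$-neighbourhood of $A$. The pair $(X,G)$ has the concentration property if every finite cover $\gamma$ of $X$ (by arbitrary subsets) contains an element $A\in\gamma$ such that for every $V\in\mathcal{U}_X$ and every finite collection $g_1,\dots,g_n\in G$, $n\geq 1$, one has $\bigcap_{i=1}^n g_i(V[A])\neq\emptyset$. *)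

(* Defs.v *)
From HB Require Import structures.
From mathcomp Require Import all_boot all_order all_algebra.
From mathcomp Require Import complex.
From mathcomp Require Import all_classical all_reals all_analysis.

Set Implicit Arguments.
Unset Strict Implicit.
Unset Printing Implicit Defensive.

Import Order.TTheory GRing.Theory Num.Theory.
Import numFieldNormedType.Exports.

Local Open Scope classical_set_scope.
Local Open Scope complex_scope.
Local Open Scope ring_scope.

(* A mean is defined on all of [G -> R], but only its values on bounded
   functions, i.e. on l^oo(G), are constrained. *)
Definition left_invariant_mean (R : realType) (G : groupType)
    (m : (G -> R) -> R) : Prop :=
  [/\ forall (a : R) (f g : G -> R), bounded_fun f -> bounded_fun g ->
        m (fun x => a * f x + g x) = a * m f + m g,
      forall f : G -> R, bounded_fun f -> (forall x, 0 <= f x) -> 0 <= m f,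
      m (fun=> 1) = 1 &
      forall (g : G) (f : G -> R), bounded_fun f ->
        m (fun x => f (g^-1 * x)%g) = m f].

Definition amenable (R : realType) (G : groupType) : Prop :=
  exists m : (G -> R) -> R, left_invariant_mean m.

(* The inverse of [uact g] is [uact g^-1], so uniform continuity of every
   [uact g] makes each of them a uniform isomorphism. *)
Record uniform_action (G : groupType) (X : uniformType) := UniformAction {
  uact :> G -> X -> X;
  uact1 : forall x, uact 1%g x = x;
  uactM : forall g h x, uact (g * h)%g x = uact g (uact h x);
  uact_unif_continuous : forall g, unif_continuous (uact g) }.

Definition entourage_nbhd (X : uniformType) (V : set (X * X)) (A : set X) :
  set X := [set y | exists2 x, A x & V (x, y)].

Definition concentration_property (G : groupType) (X : uniformType)
    (a : uniform_action G X) : Prop :=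
  forall gamma : set (set X),
    finite_set gamma -> \bigcup_(A in gamma) A = [set: X] ->
    exists2 A, gamma A &
      forall V : set (X * X), entourage V ->
      forall (n : nat) (g : 'I_n.+1 -> G),
        \bigcap_(i in [set: 'I_n.+1]) (a (g i) @` entourage_nbhd V A) !=set0.

(* The norm of a normed module over [R[i]] takes its values in [R[i]]. *)
Record hilbertSpace (R : realType) := HilbertSpace {
  hilbert_sort :> completeNormedModType R[i];
  inner : {dot hilbert_sort for Num.conj};
  inner_norm : forall x : hilbert_sort, inner x x = `|x| ^+ 2 }.

Definition infinite_dimensional (R : realType) (H : hilbertSpace R) : Prop :=
  ~ exists (n : nat) (e : 'I_n -> H),
      forall x : H, exists c : 'I_n -> R[i], x = \sum_(i < n) c i *: e i.

Definition unitary (R : realType) (H : hilbertSpace R)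
    (U : {linear H -> H}) : Prop :=
  bijective U /\ forall x y : H, inner H (U x) (U y) = inner H x y.

Record unitary_rep (R : realType) (G : groupType) (H : hilbertSpace R) :=
  UnitaryRep {
    urep :> G -> {linear H -> H};
    urep_unitary : forall g, unitary (urep g);
    urep1 : forall x, urep 1%g x = x;
    urepM : forall g h x, urep (g * h)%g x = urep g (urep h x) }.

Definition unit_sphere (R : realType) (H : hilbertSpace R) : uniformType :=
  initial_topology (val : {x : H | `|x| == 1} -> H).

Section SphereAction.
Variables (R : realType) (G : groupType) (H : hilbertSpace R).
Variable pi : unitary_rep G H.

Lemma urep_norm (g : G) (x : H) : `|pi g x| = `|x|.
Proof.
apply/eqP; rewrite -(@eqrXn2 _ 2)//; apply/eqP.
by rewrite -!inner_norm (urep_unitary pi g).2.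
Qed.

Lemma sphere_act_subproof (g : G) (x : unit_sphere H) :
  `|pi g (val x)| == 1.
Proof. by rewrite urep_norm (valP x). Qed.

Definition sphere_act (g : G) (x : unit_sphere H) : unit_sphere H :=
  Sub (pi g (val x)) (sphere_act_subproof g x).

Lemma sphere_act1 (x : unit_sphere H) : sphere_act 1%g x = x.
Proof. by apply: val_inj; rewrite /= urep1. Qed.

Lemma sphere_actM (g h : G) (x : unit_sphere H) :
  sphere_act (g * h)%g x = sphere_act g (sphere_act h x).
Proof. by apply: val_inj; rewrite /= urepM. Qed.

Lemma sphere_act_unif_continuous (g : G) : unif_continuous (sphere_act g).
Proof.
move=> E [W entW WE].
move: entW; rewrite -entourage_ballE => -[e /= e0 eW].
exists [set xy | ball xy.1 e xy.2].
  by rewrite -entourage_ballE; exists e.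
move=> [x y] /= xy; apply: WE; apply: eW => /=; move: xy.
by rewrite -!ball_normE /= -linearB urep_norm.
Qed.

Definition sphere_action : uniform_action G (unit_sphere H) :=
  UniformAction sphere_act1 sphere_actM sphere_act_unif_continuous.

End SphereAction.

(* Main.v *)
Require Import Defs.
From HB Require Import structures.
From mathcomp Require Import all_boot all_order all_algebra.
From mathcomp Require Import finmap complex ring lra.
From mathcomp Require Import all_classical all_reals all_analysis.
From mathcomp Require Import summability.

(* From left to right, let m be an invariant mean.  Iterating m gives a mean M
   on bounded functions on G^N that is invariant under the diagonal action of
   G.  Since H is infinite-dimensional, Bessel's inequality provides unit
   vectors e_1, ..., e_N such that, for M-most (h_1, ..., h_N), the vectors
   pi(h_j) e_j are almost orthogonal; the normalized sum of these vectors is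
   then an equivariant map to the sphere that is controlled by the Hamming
   distance on G^N.  A variance estimate, which only uses that M is an iterated
   mean, shows that M concentrates for the Hamming distance: if a piece A of the
   cover has a preimage of mean at least 1/(2k), then M-almost every point is
   Hamming-close to that preimage.  By invariance so are finitely many
   translates of a common point.

   From right to left, apply the hypothesis to the translation action on the
   space of square-summable functions on G x nat.  The pieces witnessing the
   concentration property contain an ultrafilter U on the sphere, and
   f |-> lim_U sum_(g, n) f(g) |xi(g, n)|^2 is an invariant mean. *)

Set Implicit Arguments.
Unset Strict Implicit.
Unset Printing Implicit Defensive.

Import Order.TTheory GRing.Theory Num.Theory.
Import numFieldNormedType.Exports.

Local Open Scope classical_set_scope.
Local Open Scope ring_scope.

(** * Iterated means and concentration for the Hamming distance *)

(** The longer list is truncated, so this is a metric only among lists of one fixed length; elements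
    of [G^N] are encoded as lists of size [N]. *)
Fixpoint hamming (T : eqType) (s t : seq T) : nat :=
  match s, t with
  | a :: s', b :: t' => (a != b) + hamming s' t'
  | _, _ => 0
  end.

Lemma hamming_refl (T : eqType) (s : seq T) : hamming s s = 0%N.
Proof. by elim: s => //= a s ->; rewrite eqxx. Qed.

Lemma hamming_triangle (T : eqType) (s t u : seq T) :
  size s = size t -> size t = size u ->
  (hamming s u <= hamming s t + hamming t u)%N.
Proof.
elim: s t u => [|a s IH] [|b t] [|c u] //= [st] [tu].
rewrite addnACA leq_add ?IH//.
by have [->|_] := eqVneq a b; [rewrite add0n | rewrite (leq_trans (leq_b1 _))].
Qed.

Lemma hamming_sym (T : eqType) (s t : seq T) : hamming s t = hamming t s.
Proof. by elim: s t => [|a s IH] [|b t] //=; rewrite eq_sym IH. Qed.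

Lemma hamming_le_size (T : eqType) (s t : seq T) : (hamming s t <= size s)%N.
Proof.
elim: s t => [|a s IH] [|b t] //=.
by rewrite -add1n leq_add// leq_b1.
Qed.

Lemma bounded_fun_exP (R : realType) (T : Type) (f : T -> R) :
  bounded_fun f <-> exists B, forall x, `|f x| <= B.
Proof.
split=> [/pinfty_ex_gt0[B _ fB]|[B fB]]; first by exists B => x; exact: fB.
exists B; split; first exact: num_real.
by move=> M BM x _; exact: le_trans (fB x) (ltW BM).
Qed.

Section IteratedMean.
Variables (R : realType) (G : groupType) (m : (G -> R) -> R).
Hypothesis mP : left_invariant_mean m.
Implicit Types (f : seq G -> R) (F : G -> R).

Lemma mean_cst (c : R) : m (fun=> c) = c.
Proof.
have [lin _ m1 _] := mP.
have b (d : R) : bounded_fun (fun _ : G => d).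
  by apply/bounded_fun_exP; exists `|d|.
have m0 : m (fun=> 0) = 0.
  have := lin 1 (fun=> 0) (fun=> 0) (b 0) (b 0).
  by rewrite (_ : (fun=> _) = fun=> 0); [lra | apply/funext=> x; lra].
have := lin c (fun=> 1) (fun=> 0) (b 1) (b 0).
rewrite m1 m0 (_ : (fun=> _) = fun=> c); last by apply/funext=> x; lra.
by move=> ->; lra.
Qed.

Lemma mean_le F1 F2 : bounded_fun F1 -> bounded_fun F2 ->
  (forall x, F1 x <= F2 x) -> m F1 <= m F2.
Proof.
move=> b1 b2 le; have [lin pos _ _] := mP.
have /pos : bounded_fun (fun x => (-1) * F1 x + F2 x).
  move: b1 b2 => /bounded_fun_exP[B1 b1] /bounded_fun_exP[B2 b2].
  apply/bounded_fun_exP; exists (B1 + B2) => x.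
  rewrite (le_trans (ler_normD _ _))// lerD//.
  by rewrite mulN1r normrN.
rewrite lin// => H.
suff: 0 <= -1 * m F1 + m F2 by lra.
by apply: H => x; have := le x; lra.
Qed.

(** The coordinates are averaged from the last to the first. Only values at lists of size [N] enter,
    and no exchange of the order of averaging is available for a finitely additive [m]. *)
Fixpoint imean (N : nat) f : R :=
  if N is N'.+1 then m (fun a => imean N' (fun h => f (a :: h))) else f [::].

Definition bdd N f := exists B, forall h, size h = N -> `|f h| <= B.

Lemma bdd_cons N f a : bdd N.+1 f -> bdd N (fun h => f (a :: h)).
Proof. by move=> [B fB]; exists B => h hN; apply: fB => /=; rewrite hN. Qed.

Lemma bdd_lin N c f g : bdd N f -> bdd N g -> bdd N (fun h => c * f h + g h).
Proof.
move=> [B fB] [C gC]; exists (`|c| * B + C) => h hN.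
rewrite (le_trans (ler_normD _ _))// normrM lerD ?gC//.
by rewrite ler_wpM2l// fB.
Qed.

Lemma bddM N f g : bdd N f -> bdd N g -> bdd N (fun h => f h * g h).
Proof.
move=> [B fB] [C gC]; exists (B * C) => h hN.
by rewrite normrM ler_pM ?fB ?gC.
Qed.

Lemma bdd_cst N c : bdd N (fun=> c).
Proof. by exists `|c|. Qed.

Lemma bdd_01 N f : (forall h, 0 <= f h <= 1) -> bdd N f.
Proof.
by move=> f01; exists 1 => h _; have /andP[f0 f1] := f01 h; rewrite ger0_norm.
Qed.

Lemma imean_cst N c : imean N (fun=> c) = c.
Proof. by elim: N => //= N ->; exact: mean_cst. Qed.

Lemma eq_imean N f g : (forall h, size h = N -> f h = g h) ->
  imean N f = imean N g.
Proof.
elim: N f g => [|N IH] f g fg /=; first exact: fg.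
congr m; apply/funext=> a; apply: IH => h hN.
by apply: fg => /=; rewrite hN.
Qed.

(** Both claims go through one induction: the bound makes the inner mean a bounded function of the
    first coordinate, and only then does monotonicity of [m] apply to it. *)
Lemma imean_bnd_le N f g : bdd N f -> bdd N g ->
  ((forall B, (forall h, size h = N -> `|f h| <= B) -> `|imean N f| <= B) *
  ((forall h, size h = N -> f h <= g h) -> imean N f <= imean N g))%type.
Proof.
elim: N f g => [|N IH] f g bf bg /=.
  by split=> [B|] /(_ [::] erefl).
have bF k : bdd N.+1 k -> bounded_fun (fun a => imean N (fun h => k (a :: h))).
  move=> bk; apply/bounded_fun_exP; case: (bk) => B kB; exists B => a.
  apply: (IH _ _ (bdd_cons a bk) (bdd_cons a bk)).1 => h hN.
  by apply: kB; rewrite /= hN.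
split=> [B fB|fg]; last first.
  apply: mean_le; [exact: bF|exact: bF|move=> a].
  apply: (IH _ _ (bdd_cons a bf) (bdd_cons a bg)).2 => h hN.
  by apply: fg; rewrite /= hN.
have H a : `|imean N (fun h => f (a :: h))| <= B.
  apply: (IH _ _ (bdd_cons a bf) (bdd_cons a bf)).1 => h hN.
  by apply: fB; rewrite /= hN.
have bc c : bounded_fun (fun _ : G => c : R) by apply/bounded_fun_exP; exists `|c|.
rewrite ler_norml -{1}(mean_cst (- B)) -{2}(mean_cst B); apply/andP; split.
  by apply: mean_le => // [|a]; [exact: bF|have := H a; rewrite ler_norml => /andP[]].
by apply: mean_le => // [|a]; [exact: bF|have := H a; rewrite ler_norml => /andP[]].
Qed.

Lemma imean_le N f g : bdd N f -> bdd N g ->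
  (forall h, size h = N -> f h <= g h) -> imean N f <= imean N g.
Proof. by move=> bf bg; exact: (imean_bnd_le bf bg).2. Qed.

Lemma bounded_imean N f : bdd N.+1 f ->
  bounded_fun (fun a => imean N (fun h => f (a :: h))).
Proof.
move=> bf; apply/bounded_fun_exP; case: (bf) => B fB; exists B => a.
apply: (imean_bnd_le (bdd_cons a bf) (bdd_cons a bf)).1 => h hN.
by apply: fB; rewrite /= hN.
Qed.

Lemma imean_lin N c f g : bdd N f -> bdd N g ->
  imean N (fun h => c * f h + g h) = c * imean N f + imean N g.
Proof.
have [lin _ _ _] := mP.
elim: N f g => //= N IH f g bf bg.
rewrite -lin; [|exact: bounded_imean|exact: bounded_imean].
by congr m; apply/funext=> a; rewrite IH//; exact: bdd_cons.
Qed.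

Lemma imeanZ N c f : bdd N f -> imean N (fun h => c * f h) = c * imean N f.
Proof.
move=> bf; rewrite -[RHS]addr0 -(imean_cst N 0) -imean_lin//.
  by apply: eq_imean => h _; rewrite addr0.
exact: bdd_cst.
Qed.

Lemma imeanD N f g : bdd N f -> bdd N g ->
  imean N (fun h => f h + g h) = imean N f + imean N g.
Proof.
move=> bf bg; rewrite -[X in X + _]mul1r -imean_lin//.
by apply: eq_imean => h _; rewrite mul1r.
Qed.

Lemma bddD N f g : bdd N f -> bdd N g -> bdd N (fun h => f h + g h).
Proof.
move=> bf /(bdd_lin 1 bf) [B H]; exists B => h hN.
by have := H _ hN; rewrite mul1r.
Qed.

Lemma bdd_sum N (I : Type) (r : seq I) (F : I -> seq G -> R) :
  (forall i, bdd N (F i)) -> bdd N (fun h => \sum_(i <- r) F i h).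
Proof.
move=> bF; elim: r => [|i r [B IH]].
  by exists 0 => h _; rewrite big_nil normr0.
have [C H] := bddD (bF i) (ex_intro _ B IH).
by exists C => h hN; rewrite big_cons H.
Qed.

Lemma imean_sum N (I : Type) (r : seq I) (F : I -> seq G -> R) :
  (forall i, bdd N (F i)) ->
  imean N (fun h => \sum_(i <- r) F i h) = \sum_(i <- r) imean N (F i).
Proof.
move=> bF; elim: r => [|i r IH].
  rewrite big_nil -[RHS](imean_cst N); apply: eq_imean => h _.
  by rewrite big_nil.
rewrite big_cons -IH -imeanD//; last exact: bdd_sum.
by apply: eq_imean => h _; rewrite big_cons.
Qed.

Lemma imean_translate N g f : bdd N f ->
  imean N (fun h => f (map (fun x => g * x)%g h)) = imean N f.
Proof.
have [_ _ _ inv] := mP.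
elim: N f => //= N IH f bf.
(* The definition of an invariant mean shifts by an inverse, so a shift by [g] uses it at [g^-1]. *)
rewrite -(inv g^-1%g (fun a => imean N (fun h => f (a :: h)))); last first.
  exact: bounded_imean.
congr m; apply/funext=> a; rewrite invgK.
by rewrite (IH (fun h => f ((g * a)%g :: h)))//; exact: bdd_cons.
Qed.

Lemma lip_bdd N f : (forall h h', size h = N -> size h' = N ->
  `|f h - f h'| <= (hamming h h')%:R) -> bdd N f.
Proof.
move=> lip; have [h0 h0N] : exists h0 : seq G, size h0 = N.
  by exists (nseq N 1%g); rewrite size_nseq.
exists (`|f h0| + N%:R) => h hN.
rewrite -[f h](subrK (f h0)) addrC (le_trans (ler_normD _ _))// lerD2l.
by rewrite (le_trans (lip _ _ hN h0N))// ler_nat -hN hamming_le_size.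
Qed.

(** The mean [F] over the remaining coordinates oscillates by at most 1 in the first one, so each
    coordinate adds at most 1 to the variance. *)
Lemma imean_variance N f : (forall h h', size h = N -> size h' = N ->
    `|f h - f h'| <= (hamming h h')%:R) ->
  imean N (fun h => f h ^+ 2) <= imean N f ^+ 2 + N%:R.
Proof.
elim: N f => [|N IH] f lip /=; first by rewrite addr0.
have bf := lip_bdd lip.
have bf2 : bdd N.+1 (fun h => f h ^+ 2) by exact: bddM.
pose F a := imean N (fun h => f (a :: h)).
have bF : bounded_fun F by exact: bounded_imean.
have bc c : bounded_fun (fun _ : G => c : R) by apply/bounded_fun_exP; exists `|c|.
have Fosc a b : F a <= F b + 1.
  rewrite -[X in F b + X](imean_cst N) -imeanD; last 2 first.
    exact: bdd_cons.
    exact: bdd_cst.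
  apply: imean_le; first exact: bdd_cons.
    by apply: bddD; [exact: bdd_cons|exact: bdd_cst].
  move=> h hN; have := lip (a :: h) (b :: h).
  rewrite /= hN hamming_refl addn0 => /(_ erefl erefl) /ler_normlW fab.
  have ab1 : ((a != b)%:R : R) <= 1 by rewrite lern1 leq_b1.
  lra.
have Fdev a : (F a - m F) ^+ 2 <= 1.
  have le1 : m F <= F a + 1.
    by rewrite -[leRHS]mean_cst; apply: mean_le.
  have le2 : F a - 1 <= m F.
    rewrite -[leLHS]mean_cst; apply: mean_le => // b.
    by have := Fosc a b; lra.
  by rewrite -real_normK ?num_real// expr_le1// ler_norml; apply/andP; split; lra.
have [lin _ _ _] := mP.
(* Expanding [(F a - m F) ^+ 2 <= 1] bounds [F a ^+ 2] by an expression affine in [F a]; after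
   adding [N], its mean follows by linearity and equals [m F ^+ 2 + 1 + N]. *)
have b2 : bounded_fun (fun a => 2 * m F * F a + (1 - m F ^+ 2 + N%:R)).
  move/bounded_fun_exP : bF => [B FB]; apply/bounded_fun_exP.
  exists (`|2 * m F| * B + `|1 - m F ^+ 2 + N%:R|) => a.
  by rewrite (le_trans (ler_normD _ _))// lerD// normrM ler_wpM2l.
have H : m (fun a => imean N (fun h => f (a :: h) ^+ 2)) <=
    m (fun a => 2 * m F * F a + (1 - m F ^+ 2 + N%:R)).
  apply: mean_le => //; first exact: (bounded_imean bf2).
  move=> a; have : imean N (fun h => f (a :: h) ^+ 2) <= F a ^+ 2 + N%:R.
    by apply: IH => h h' hN h'N; have := lip (a :: h) (a :: h');
      rewrite /= eqxx add0n hN h'N => /(_ erefl erefl).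
  by have := Fdev a; nra.
apply: (le_trans H); rewrite lin// mean_cst -/F -natr1; nra.
Qed.

Lemma bdd_indic N (A : set (seq G)) : bdd N \1_A.
Proof. by apply: bdd_01 => h; rewrite indicE; case: (_ \in _); rewrite ?ler01 ?lexx. Qed.

Lemma imean_indicU N (A B : set (seq G)) :
  imean N \1_(A `|` B) <= imean N \1_A + imean N \1_B.
Proof.
rewrite -imeanD; [|exact: bdd_indic|exact: bdd_indic].
apply: imean_le; first exact: bdd_indic.
  by apply: bddD; exact: bdd_indic.
move=> h _; rewrite !indicE in_setU.
by case: (_ \in _); case: (_ \in _); rewrite /= ?addr0 ?add0r ?ler01// lerDl.
Qed.

Lemma imean_indic_inhabited N (A : set (seq G)) :
  0 < imean N \1_A -> exists2 h, A h & size h = N.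
Proof.
move=> A0; apply: contrapT => H; move: A0.
rewrite (@eq_imean _ _ (fun=> 0)) ?imean_cst ?ltxx// => h hN.
by rewrite indicE memNset// => Ah; apply: H; exists h.
Qed.

Lemma imean_markov N f (A : set (seq G)) c : bdd N f ->
  (forall h, size h = N -> 0 <= f h) ->
  (forall h, size h = N -> A h -> c <= f h) -> 
  c * imean N \1_A <= imean N f.
Proof.
move=> bf f0 Af; rewrite -imeanZ; last exact: bdd_indic.
apply: imean_le => //; first by apply: bddM; [exact: bdd_cst|exact: bdd_indic].
move=> h hN; rewrite indicE; have [Ah|_] := boolP (h \in A).
  by rewrite mulr1; apply: Af => //; exact: set_mem.
by rewrite mulr0 f0.
Qed.

(* Chebyshev's inequality for the distance to [A], whose mean is controlled
   by the fact that the distance vanishes on [A]. *)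
Lemma hamming_concentration N (A : set (seq G)) c t : 0 < c -> 0 < t ->
  c <= imean N \1_A ->
  c * t ^+ 2 * imean N \1_[set h | forall h', A h' -> size h' = N ->
                                    t <= (hamming h h')%:R] <= 2 * N%:R.
Proof.
move=> c0 t0 cA; have [h0 Ah0 h0N] := imean_indic_inhabited (lt_le_trans c0 cA).
pose E h := [set r : R | exists2 h', A h' /\ size h' = N &
                          r = (hamming h h')%:R].
pose phi h := inf (E h).
have Elb h : has_inf (E h).
  split; first by exists (hamming h h0)%:R; exists h0.
  by exists 0 => _ [h' _ ->].
have phi_ge0 h : 0 <= phi h.
  by apply: lb_le_inf; [exact: (Elb h).1|move=> _ [h' _ ->]].
have phi_le h h' : A h' -> size h' = N -> phi h <= (hamming h h')%:R.
  by move=> Ah' h'N; apply: ge_inf; [exact: (Elb h).2|exists h'].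
have phiA h : A h -> size h = N -> phi h = 0.
  move=> Ah hN; apply/eqP; rewrite eq_le phi_ge0 andbT.
  by rewrite (le_trans (phi_le _ _ Ah hN))// hamming_refl.
have phi_lip1 h h' : size h = N -> size h' = N ->
    phi h <= phi h' + (hamming h h')%:R.
  move=> hN h'N; rewrite -lerBlDr; apply: lb_le_inf; first exact: (Elb h').1.
  move=> _ [k [Ak kN] ->]; rewrite lerBlDr addrC (le_trans (phi_le _ _ Ak kN))//.
  by rewrite -natrD ler_nat hamming_triangle ?hN ?h'N.
have lip h h' : size h = N -> size h' = N ->
    `|phi h - phi h'| <= (hamming h h')%:R.
  move=> hN h'N; rewrite ler_norml; apply/andP; split.
    by have := phi_lip1 _ _ h'N hN; rewrite hamming_sym; lra.
  by have := phi_lip1 _ _ hN h'N; lra.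
have bphi := lip_bdd lip; have var := imean_variance lip.
have bphi2 : bdd N (fun h => phi h ^+ 2) by exact: bddM.
set mu := imean N phi in var.
(* On [A] the distance [phi] vanishes and its squared deviation is [mu ^+ 2]; with the variance
   bound this yields [c * mu ^+ 2 <= N]. *)
have muA : mu ^+ 2 * imean N \1_A <= imean N (fun h => (phi h - mu) ^+ 2).
  apply: imean_markov.
  - by apply: bddM; apply: bddD => //; exact: bdd_cst.
  - by move=> h _; exact: sqr_ge0.
  - by move=> h hN Ah; rewrite phiA// sub0r sqrrN.
have dev : imean N (fun h => (phi h - mu) ^+ 2) <= N%:R.
  rewrite (@eq_imean _ _ (fun h => (-2 * mu) * phi h + (phi h ^+ 2 + mu ^+ 2))).
    rewrite imean_lin// ?imeanD//; [|exact: bdd_cst|].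
      by rewrite imean_cst -/mu; nra.
    by apply: bddD => //; exact: bdd_cst.
  by move=> h _; ring.
have A1 : imean N \1_A <= 1.
  rewrite -[leRHS](imean_cst N); apply: imean_le; [exact: bdd_indic|exact: bdd_cst|].
  by move=> h _; rewrite indicE lern1 leq_b1.
have far : t ^+ 2 * imean N \1_[set h | forall h', A h' -> size h' = N ->
    t <= (hamming h h')%:R] <= imean N (fun h => phi h ^+ 2).
  apply: imean_markov => // h hN; first exact: sqr_ge0.
  move=> fh; rewrite ler_sqr ?nnegrE ?(ltW t0)//.
  by apply: lb_le_inf; [exact: (Elb h).1|move=> _ [h' [Ah' h'N] ->]; exact: fh].
have cmu : c * mu ^+ 2 <= N%:R.
  by apply: le_trans (le_trans muA dev); rewrite mulrC ler_wpM2l// sqr_ge0.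
have N0 : 0 <= N%:R :> R by [].
(* The left side is at most [c * (mu ^+ 2 + N)], and both [c * mu ^+ 2] and [c * N] are at most [N]
   because [c <= 1]. *)
rewrite -mulrA (le_trans (ler_wpM2l (ltW c0) (le_trans far var)))//.
by rewrite mulrDr; have : c <= 1 := le_trans cA A1; nra.
Qed.

End IteratedMean.

(** * The real part of the inner product *)

Section RealInnerProduct.
Local Open Scope complex_scope.
Variables (R : realType) (H : hilbertSpace R).
Implicit Types (x y z : H) (a : R).

(** Lengths and distances depend only on the real part of the inner product, so the geometry below
    is that of the underlying real Hilbert space. *)
Definition rip x y : R := complex.Re (inner H x y).
Definition rnorm x : R := complex.Re `|x|.

Lemma rnormE x : `|x| = (rnorm x)%:C.
Proof. by rewrite /rnorm RRe_real// normr_real. Qed.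

Lemma rnorm_ge0 x : 0 <= rnorm x.
Proof. by rewrite -ler0c -rnormE. Qed.

Lemma rip_norm x : rip x x = rnorm x ^+ 2.
Proof. by rewrite /rip inner_norm rnormE -rmorphXn. Qed.

Lemma ripC x y : rip x y = rip y x.
Proof. by apply: complexI; rewrite /rip hermC expr0 mul1r !complexRe Re_conj. Qed.

Lemma ripDl x y z : rip (x + y) z = rip x z + rip y z.
Proof. by rewrite /rip linearDl raddfD. Qed.

Lemma ripDr x y z : rip x (y + z) = rip x y + rip x z.
Proof. by rewrite ripC ripDl !(ripC x). Qed.

Lemma ripZl a x y : rip (a%:C *: x) y = a * rip x y.
Proof.
rewrite /rip linearZl_LR /=; case: (inner H x y) => p q /=.
by rewrite mul0r subr0.
Qed.

Lemma ripZr a x y : rip x (a%:C *: y) = a * rip x y.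
Proof. by rewrite ripC ripZl ripC. Qed.

Lemma ripNl x y : rip (- x) y = - rip x y.
Proof. by rewrite /rip linearNl raddfN. Qed.

Lemma ripNr x y : rip x (- y) = - rip x y.
Proof. by rewrite ripC ripNl ripC. Qed.

Lemma rip0l x : rip 0 x = 0.
Proof. by rewrite -[X in rip X _](subrr 0) ripDl ripNl subrr. Qed.

Lemma rip_suml I (r : seq I) (F : I -> H) y :
  rip (\sum_(i <- r) F i) y = \sum_(i <- r) rip (F i) y.
Proof. by elim/big_rec2 : _ => [|i a x _ <-]; rewrite ?rip0l ?ripDl. Qed.

Lemma rip_sumr I (r : seq I) (F : I -> H) y :
  rip y (\sum_(i <- r) F i) = \sum_(i <- r) rip y (F i).
Proof. by rewrite ripC rip_suml; apply: eq_bigr => i _; exact: ripC. Qed.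

Lemma rip_ge0 x : 0 <= rip x x.
Proof. by rewrite rip_norm sqr_ge0. Qed.

Lemma rip_eq0 x : rip x x = 0 -> x = 0.
Proof.
rewrite rip_norm => /eqP; rewrite sqrf_eq0 => /eqP x0.
by apply/eqP; rewrite -normr_eq0 rnormE x0.
Qed.

Definition real_orthonormal L (v : 'I_L -> H) :=
  forall i j, rip (v i) (v j) = (i == j)%:R.

Lemma real_residual_orthogonal L (v : 'I_L -> H) x j : real_orthonormal v ->
  rip (x - \sum_i (rip x (v i))%:C *: v i) (v j) = 0.
Proof.
move=> ov; rewrite ripDl ripNl rip_suml (bigD1 j)//= big1 ?addr0.
  by rewrite ripZl ov eqxx mulr1 subrr.
by move=> i /negPf ij; rewrite ripZl ov ij mulr0.
Qed.

(** The residual [y] of the projection is orthogonal to every [v i], so [rip y y = rip y x], which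
    is the difference of the two sides. *)
Lemma bessel L (v : 'I_L -> H) x : real_orthonormal v ->
  \sum_i rip x (v i) ^+ 2 <= rip x x.
Proof.
move=> ov; set y := x - \sum_i (rip x (v i))%:C *: v i.
have yv j : rip y (v j) = 0 by exact: real_residual_orthogonal.
have yy : rip y y = rip y x.
  rewrite {2}/y ripDr ripNr rip_sumr big1 ?subr0// => j _.
  by rewrite ripZr yv mulr0.
have : 0 <= rip y y by exact: rip_ge0.
rewrite yy /y ripDl ripNl rip_suml subr_ge0.
by under eq_bigr do rewrite ripZl (ripC _ x) -expr2.
Qed.

(** Gram-Schmidt: some [x] lies outside the complex span of the vectors already found, so its
    residual, whose coefficients are real, is nonzero and can be normalized. *)
Lemma exists_real_orthonormal L : infinite_dimensional H ->
  exists v : 'I_L -> H, real_orthonormal v.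
Proof.
move=> infH; elim: L => [|L [v ov]]; first by exists (fun=> 0) => -[].
have [x xv] : exists x, forall c : 'I_L -> R[i], x <> \sum_i c i *: v i.
  apply: contrapT => nx; apply: infH; exists L, v => x.
  by apply: contrapT => nc; apply: nx; exists x => c xc; apply: nc; exists c.
set y := x - \sum_i (rip x (v i))%:C *: v i.
have yv j : rip y (v j) = 0 by exact: real_residual_orthogonal.
have y0 : rnorm y != 0.
  apply/eqP => y0; have : y = 0 by apply: rip_eq0; rewrite rip_norm y0 expr0n.
  by move/eqP; rewrite subr_eq0 => /eqP; exact: xv.
pose e := (rnorm y)^-1%:C *: y.
have ev j : rip e (v j) = 0 by rewrite ripZl yv mulr0.
have ee : rip e e = 1 by rewrite ripZl ripZr rip_norm; field.
exists (fun i => if unlift ord0 i is Some j then v j else e) => i j.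
case: (unliftP ord0 i) => [i'|] ->; case: (unliftP ord0 j) => [j'|] ->.
- by rewrite ov (inj_eq lift_inj).
- by rewrite ripC ev eq_sym (negPf (neq_lift _ _)).
- by rewrite ev (negPf (neq_lift _ _)).
- by rewrite ee eqxx.
Qed.

(** Cauchy-Schwarz against a unit vector, as Bessel's inequality for a family of one vector. *)
Lemma rip_sqr_unit x y : rip y y = 1 -> rip x y ^+ 2 <= rip x x.
Proof.
move=> y1; have := @bessel 1 (fun=> y) x; rewrite big_ord1; apply => i j.
by rewrite y1 !ord1.
Qed.

Lemma rip_unit_distance x y : 0 < rnorm x -> 0 < rnorm y ->
  rnorm ((rnorm x)^-1%:C *: x - (rnorm y)^-1%:C *: y) ^+ 2 =
  (2 * rnorm x * rnorm y - 2 * rip x y) / (rnorm x * rnorm y).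
Proof.
move=> x0 y0; rewrite -rip_norm !(ripDl, ripDr, ripNl, ripNr, ripZl, ripZr).
rewrite (ripC y x) !rip_norm; field.
by rewrite !gt_eqF.
Qed.

Lemma rnorm_sub_sqr x y :
  rnorm (x - y) ^+ 2 = rnorm x ^+ 2 + rnorm y ^+ 2 - 2 * rip x y.
Proof.
rewrite -!rip_norm !(ripDl, ripDr, ripNl, ripNr) (ripC y x); ring.
Qed.

(** The squared distance of the normalized vectors has denominator [rnorm x * rnorm y >= c], and its
    numerator is at most [rnorm (x - y) ^+ 2] since [2 * rnorm x * rnorm y <= rnorm x ^+ 2 + rnorm y
    ^+ 2]. *)
Lemma normalize_lipschitz x y c : 0 < c -> c <= rnorm x ^+ 2 ->
  c <= rnorm y ^+ 2 ->
  c * rnorm ((rnorm x)^-1%:C *: x - (rnorm y)^-1%:C *: y) ^+ 2 <=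
  rnorm (x - y) ^+ 2.
Proof.
move=> c0 cx cy.
have pos z : c <= rnorm z ^+ 2 -> 0 < rnorm z.
  move=> cz; rewrite lt_neqAle rnorm_ge0 andbT eq_sym.
  by apply: contraTneq cz => ->; rewrite expr0n/= -ltNge.
have x0 := pos _ cx; have y0 := pos _ cy.
have xy0 : 0 < rnorm x * rnorm y by rewrite mulr_gt0.
have cxy : c <= rnorm x * rnorm y.
  rewrite -ler_sqr ?nnegrE ?(ltW c0) ?(ltW xy0)// exprMn expr2.
  by rewrite ler_pM// ltW.
set d := rnorm (_ - _) ^+ 2.
have d0 : 0 <= d by exact: sqr_ge0.
rewrite (le_trans (ler_wpM2r d0 cxy))// /d rip_unit_distance//.
rewrite mulrC divfK ?gt_eqF// rnorm_sub_sqr.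
by have := sqr_ge0 (rnorm x - rnorm y); rewrite sqrrB; lra.
Qed.

(** The sum of the squares of the Gram matrix entries above the diagonal. The recursion on the list
    matches that of [imean], separating the first vector from the others. *)
Definition gram_defect : seq H -> R := fix Q us :=
  if us is u :: us' then \sum_(w <- us') rip u w ^+ 2 + Q us' else 0.

Lemma gram_defect_ge0 us : 0 <= gram_defect us.
Proof.
by elim: us => //= u us IH; rewrite addr_ge0// sumr_ge0// => w _; exact: sqr_ge0.
Qed.

Lemma gram_defect_le us : {in us, forall u, rip u u = 1} ->
  gram_defect us <= (size us)%:R ^+ 2.
Proof.
elim: us => [|u us IH] u1 /=; first exact: sqr_ge0.
have us1 : {in us, forall u, rip u u = 1}.
  by move=> w wus; rewrite u1// inE wus orbT.
have le : \sum_(w <- us) rip u w ^+ 2 <= (size us)%:R.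
  rewrite -sum1_size natr_sum; rewrite [leLHS]big_seq [leRHS]big_seq; apply: ler_sum => w wus.
  by rewrite -(us1 w wus) ripC rip_sqr_unit// u1// mem_head.
have := IH us1; rewrite -natr1.
by have : 0 <= (size us)%:R :> R by []; nra.
Qed.

Lemma gram_defect_pairwise us c : gram_defect us <= c ->
  pairwise (fun u w => rip u w ^+ 2 <= c) us.
Proof.
elim: us c => //= u us IH c le.
have Q0 := gram_defect_ge0 us.
have S0 : 0 <= \sum_(w <- us) rip u w ^+ 2.
  by apply: sumr_ge0 => w _; exact: sqr_ge0.
apply/andP; split; last by apply: IH; lra.
apply/allP => w wus; apply: (@le_trans _ _ (\sum_(w <- us) rip u w ^+ 2)); last lra.
by rewrite (big_rem w)//= lerDl sumr_ge0// => ? _; exact: sqr_ge0.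
Qed.

(** Expanding the square, the diagonal contributes exactly [size us], and each of the fewer than
    [(size us) ^+ 2] other terms of a nonempty family is at most [t] in absolute value. *)
Lemma rip_sum_near us t : 0 <= t -> {in us, forall u, rip u u = 1} ->
  pairwise (fun u w => rip u w ^+ 2 <= t ^+ 2) us ->
  `|rnorm (\sum_(u <- us) u) ^+ 2 - (size us)%:R| <= (size us)%:R ^+ 2 * t.
Proof.
move=> t0; rewrite -rip_norm; elim: us => [|u us IH] u1 /=.
  by rewrite big_nil rip0l subrr normr0 mulr_ge0 ?sqr_ge0.
move=> /andP[/allP ut pt].
have us1 : {in us, forall u, rip u u = 1}.
  by move=> w wus; rewrite u1// inE wus orbT.
have cross : `|rip u (\sum_(w <- us) w)| <= (size us)%:R * t.
  rewrite rip_sumr (le_trans (ler_norm_sum _ _ _))//.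
  rewrite -sum1_size natr_sum mulr_suml; rewrite [leLHS]big_seq [leRHS]big_seq; apply: ler_sum => w wus.
  by rewrite mul1r -ler_sqr ?nnegrE// real_normK ?num_real// ut.
rewrite big_cons !(ripDl, ripDr) (ripC _ u) u1 ?mem_head//.
have := IH us1 pt; move: cross; rewrite !ler_norml -natr1.
move=> /andP[c1 c2] /andP[i1 i2].
by have : 0 <= (size us)%:R :> R by []; move=> s0; apply/andP; split; nra.
Qed.

End RealInnerProduct.

(** * Amenability implies concentration *)

Section AmenableConcentration.
Local Open Scope complex_scope.
Variables (R : realType) (G : groupType) (m : (G -> R) -> R).
Hypothesis mP : left_invariant_mean m.
Variables (H : hilbertSpace R) (pi : unitary_rep G H).
Implicit Types (es us : seq H) (h : seq G).

Lemma rip_urep g x y : rip (pi g x) (pi g y) = rip x y.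
Proof. by rewrite /rip (urep_unitary pi g).2. Qed.

Definition translates es h : seq H := [seq pi p.2 p.1 | p <- zip es h].

Lemma size_translates es h : size h = size es ->
  size (translates es h) = size es.
Proof. by move=> hN; rewrite size_map size_zip hN minnn. Qed.

Lemma translates_unit es h : {in es, forall e, rip e e = 1} ->
  {in translates es h, forall u, rip u u = 1}.
Proof.
move=> es1 u /mapP[[e g]] + -> /=; rewrite rip_urep => eg; apply: es1.
by elim: es h eg => [|e' es IH] [|g' h] //=; rewrite !inE xpair_eqE
  => /orP[/andP[-> _]//|/IH ->]; rewrite orbT.
Qed.

Lemma translates_mulg es h g :
  translates es (map (fun x => g * x)%g h) = map (pi g) (translates es h).
Proof.
elim: es h => [|e es IH] [|a h] //=; rewrite /translates /= -/(translates _ _).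
by congr cons; [rewrite urepM | exact: IH].
Qed.

Lemma bdd_gram_defect es : {in es, forall e, rip e e = 1} ->
  bdd (size es) (fun h => gram_defect (translates es h)).
Proof.
move=> es1; exists ((size es)%:R ^+ 2) => h hN.
rewrite ger0_norm ?gram_defect_ge0// -(size_translates hN).
by apply: gram_defect_le; exact: translates_unit.
Qed.

(** The increase of the Gram defect when [v] is put in front of the translated vectors. *)
Definition correlation es v h := \sum_(w <- translates es h) rip v w ^+ 2.

Lemma bdd_correlation es v : {in es, forall e, rip e e = 1} ->
  bdd (size es) (correlation es v).
Proof.
move=> es1; exists ((size es)%:R * rip v v) => h hN.
rewrite ger0_norm; last by apply: sumr_ge0 => w _; exact: sqr_ge0.
rewrite -(size_translates hN) -sum1_size natr_sum mulr_suml.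
rewrite [leLHS]big_seq [leRHS]big_seq; apply: ler_sum => w wus.
by rewrite mul1r rip_sqr_unit// (translates_unit es1 wus).
Qed.

(* Translating [v] by [a] amounts to translating [h] by [a^-1], so invariance
   of the iterated mean removes [a]. *)
Lemma imean_correlation_urep es v a : {in es, forall e, rip e e = 1} ->
  imean m (size es) (correlation es (pi a v)) =
  imean m (size es) (correlation es v).
Proof.
move=> es1; rewrite -(imean_translate mP a); last exact: bdd_correlation.
apply: eq_imean => h _; rewrite /correlation translates_mulg big_map.
by apply: eq_bigr => w _; rewrite rip_urep.
Qed.

(** An averaging argument: by Bessel, the correlations with [L] orthonormal vectors sum to at most
    [N] at every point, so one of them has mean at most [N / L]. *)
Lemma exists_uncorrelated es d : infinite_dimensional H -> 0 < d ->
  {in es, forall e, rip e e = 1} ->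
  exists2 v : H, rip v v = 1 & imean m (size es) (correlation es v) <= d.
Proof.
move=> infH d0 es1; set N := size es.
(* This choice gives [L * d > N]. *)
pose L := (Num.truncn (N%:R / d)).+1.
have LN : N%:R < L%:R * d.
  by rewrite -ltr_pdivrMr// truncnS_gt.
have [v ov] := exists_real_orthonormal L infH.
have v1 i : rip (v i) (v i) = 1 by rewrite ov eqxx.
have sumv : \sum_i imean m N (correlation es (v i)) <= N%:R.
  rewrite -imean_sum//; last by move=> i; exact: bdd_correlation.
  rewrite -(imean_cst mP N N%:R); apply: imean_le => //.
  - by apply: bdd_sum => i; exact: bdd_correlation.
  - exact: bdd_cst.
  move=> h hN; rewrite /correlation exchange_big/=.
  rewrite /N -(size_translates hN) -sum1_size natr_sum.
  rewrite [leLHS]big_seq [leRHS]big_seq; apply: ler_sum => w wus.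
  rewrite -(translates_unit es1 wus).
  by under eq_bigr do rewrite ripC; exact: bessel.
apply: contrapT => nv.
have : L%:R * d <= \sum_i imean m N (correlation es (v i)).
  rewrite mulr_natl -[L in _ *+ L]card_ord -sumr_const; apply: ler_sum => i _.
  by rewrite leNgt; apply/negP => lt; apply: nv; exists (v i) => //; exact: ltW.
by move: LN sumv; lra.
Qed.

(** Vectors are added one at a time: half of [d] is allotted to the pairs already present and half
    to the pairs involving the new vector. *)
Lemma exists_almost_orthogonal N d : infinite_dimensional H -> 0 < d ->
  exists es, [/\ size es = N, {in es, forall e, rip e e = 1} &
    imean m N (fun h => gram_defect (translates es h)) <= d].
Proof.
move=> infH; elim: N d => [|N IH] d d0.
  by exists [::]; split => //=; exact: ltW.
have d2 : 0 < d / 2 by rewrite divr_gt0.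
have [es [esN es1 esd]] := IH _ d2.
have [v v1 vd] := exists_uncorrelated infH d2 es1.
exists (v :: es); split; first by rewrite /= esN.
  by move=> e; rewrite inE => /predU1P[->//|/es1].
(* The mean correlation with [pi a v] does not depend on [a], so the outer mean is that of a
   constant. *)
rewrite /= (_ : (fun a => _) = fun=> imean m N (correlation es v) +
    imean m N (fun h => gram_defect (translates es h))).
  by rewrite mean_cst//; rewrite esN in vd; lra.
apply/funext => a; rewrite -esN -(imean_correlation_urep v a es1) -imeanD//.
- exact: bdd_correlation.
- exact: bdd_gram_defect.
Qed.

(** The mask [b] marks the positions where [h] and [h'] differ; at all the others the two terms
    coincide and cancel. *)
Lemma sum_translates_sub es h h' : size h = size es -> size h' = size es ->
  exists b : bitseq,
    [/\ size b = size es, count id b = hamming h h' &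
    \sum_(u <- translates es h) u - \sum_(u <- translates es h') u =
    \sum_(u <- mask b (translates es h)) u -
    \sum_(u <- mask b (translates es h')) u].
Proof.
elim: es h h' => [|e es IH] [|a h] [|a' h'] //=.
  by move=> _ _; exists [::]; split => //; rewrite big_nil.
move=> [hN] [h'N]; have [b [bN bc bE]] := IH _ _ hN h'N.
exists ((a != a') :: b); split; rewrite /= ?bN ?bc//.
rewrite /translates /= -!/(translates _ _).
rewrite 2![in LHS]big_cons opprD addrACA bE.
by have [->|_] /= := eqVneq a a'; rewrite ?subrr ?add0r// !big_cons opprD addrACA.
Qed.

(** After cancellation each sum has [D] almost orthogonal unit vectors, where [D] is the Hamming
    distance, hence squared norm at most [D * (1 + D * t)]. *)
Lemma rnorm_sum_sub_le es h h' t : 0 <= t -> size h = size es ->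
  size h' = size es -> {in es, forall e, rip e e = 1} ->
  gram_defect (translates es h) <= t ^+ 2 ->
  gram_defect (translates es h') <= t ^+ 2 ->
  rnorm (\sum_(u <- translates es h) u - \sum_(u <- translates es h') u) ^+ 2
  <= 4 * (hamming h h')%:R * (1 + (hamming h h')%:R * t).
Proof.
move=> t0 hN h'N es1 ht h't; have [b [bN bc ->]] := sum_translates_sub hN h'N.
set D := hamming h h' in bc *.
have near k : size k = size es -> gram_defect (translates es k) <= t ^+ 2 ->
    rnorm (\sum_(u <- mask b (translates es k)) u) ^+ 2 <= D%:R * (1 + D%:R * t).
  move=> kN kt; have sD : size (mask b (translates es k)) = D.
    by rewrite size_mask ?bc// bN size_translates.
  have /ler_normlW : `|rnorm (\sum_(u <- mask b (translates es k)) u) ^+ 2 -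
      D%:R| <= D%:R ^+ 2 * t.
    rewrite -sD; apply: rip_sum_near => //.
      by move=> u /mem_mask; exact: translates_unit.
    exact: pairwise_mask (gram_defect_pairwise kt).
  by lra.
have := near _ hN ht; have := near _ h'N h't.
rewrite rnorm_sub_sqr; set x := \sum_(_ <- _) _; set y := \sum_(_ <- _) _.
(* Nonnegativity of this square gives the bound of [rnorm (x - y) ^+ 2] by twice the sum of the two
   squared norms. *)
have := sqr_ge0 (rnorm (x + y)).
by rewrite -!rip_norm !(ripDl, ripDr) (ripC x y); lra.
Qed.

(** With [t = 1 / (2 * N)] the error [N ^+ 2 * t] in the squared norm of the sum is [N / 2]. *)
Lemma rnorm_sum_translates_ge es h : size h = size es ->
  {in es, forall e, rip e e = 1} ->
  gram_defect (translates es h) <= ((2 * (size es)%:R)^-1) ^+ 2 ->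
  (size es)%:R / 2 <= rnorm (\sum_(u <- translates es h) u) ^+ 2.
Proof.
set N := size es; set t := _^-1 => hN es1 ht.
have t0 : 0 <= t by rewrite invr_ge0 mulr_ge0.
have Nt : N%:R * t <= 1 / 2.
  have [->|N0] := posnP N; first by rewrite mul0r divr_ge0.
  by rewrite /t le_eqVlt; apply/orP; left; apply/eqP; field;
    rewrite pnatr_eq0 -lt0n.
have := rip_sum_near t0 (translates_unit es1) (gram_defect_pairwise ht).
rewrite size_translates// -/N expr2 -mulrA ler_norml => /andP[+ _].
have := ler_wpM2l (ler0n R N) Nt; lra.
Qed.

(** As the Hamming distance [D] is at most [N], [D * t <= 1 / 2] and the sums differ by at most
    [6 * D] in squared norm; normalizing vectors of squared norm at least [N / 2] doubles the
    constant to 12. *)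
Lemma normalized_translates_close es h h' : size h = size es ->
  size h' = size es -> {in es, forall e, rip e e = 1} ->
  let N := size es in let t := (2 * N%:R)^-1 in
  let s k := \sum_(u <- translates es k) u in
  let x k := (rnorm (s k))^-1%:C *: s k in
  gram_defect (translates es h) <= t ^+ 2 ->
  gram_defect (translates es h') <= t ^+ 2 ->
  N%:R * rnorm (x h - x h') ^+ 2 <= 12 * (hamming h h')%:R.
Proof.
move=> hN h'N es1 N t s x ht h't; have [N0|N0] := posnP N.
  by rewrite N0 mul0r mulr_ge0.
have NR : 0 < N%:R :> R by rewrite ltr0n.
have t0 : 0 <= t by rewrite invr_ge0 mulr_ge0.
have Nt : N%:R * t = 1 / 2 by rewrite /t; field; rewrite gt_eqF.
have big k : size k = N -> gram_defect (translates es k) <= t ^+ 2 ->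
    N%:R / 2 <= rnorm (s k) ^+ 2.
  by move=> kN kt; exact: rnorm_sum_translates_ge.
have := normalize_lipschitz (divr_gt0 NR (ltr0n _ 2)) (big _ hN ht) (big _ h'N h't).
have := rnorm_sum_sub_le t0 hN h'N es1 ht h't; rewrite -/(s h) -/(s h') -/(x h) -/(x h').
have D0 : 0 <= (hamming h h')%:R :> R by [].
have : (hamming h h')%:R * t <= 1 / 2.
  by rewrite -Nt ler_wpM2r// ler_nat -[leqRHS]hN hamming_le_size.
set D := (hamming h h')%:R; set y := rnorm _ ^+ 2; set z := rnorm _ ^+ 2.
nra.
Qed.

(** The union bound: if the sets covered all lists of size [N], their indicators would sum to at
    least 1 everywhere. *)
Lemma imean_union N (I : eqType) (r : seq I) (A : I -> set (seq G)) :
  \sum_(i <- r) imean m N \1_(A i) < 1 ->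
  exists2 h, size h = N & forall i, i \in r -> ~ A i h.
Proof.
move=> lt1; apply: contrapT => nh; move: lt1; apply/negP; rewrite -leNgt.
rewrite -imean_sum//; last by move=> i; exact: bdd_indic.
rewrite -[leLHS](imean_cst mP N); apply: imean_le => //; first exact: bdd_cst.
  by apply: bdd_sum => i; exact: bdd_indic.
move=> h hN; have [i ir Ai] : exists2 i, i \in r & A i h.
  apply: contrapT => ni; apply: nh; exists h => // i ir Ai.
  by apply: ni; exists i.
rewrite (big_rem i)//= indicE mem_set// lerDl sumr_ge0//.
Qed.

(** Here the piece [A] may depend on [gs] and [e]; a piece that serves all of them is extracted
    afterwards from the finiteness of the cover. *)
Lemma finite_cover_concentration (s : seq (set (unit_sphere H))) (gs : seq G)
    (e : R) : infinite_dimensional H -> 0 < e ->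
  (forall x, exists2 A, A \in s & A x) ->
  exists2 A, A \in s &
    exists x : unit_sphere H, forall g, g \in gs ->
      exists2 y, A y & rnorm (val y - pi g^-1%g (val x)) < e.
Proof.
move=> infH e0 cov.
(* Each of the [size gs + 1] translates will exclude a set of mean at most [2 * eta], for a total of
   at most [1 / 2]. *)
pose eta : R := (2 * (size gs).+1%:R)^-1 / 2.
have sgs0 : 0 < (size gs).+1%:R :> R by rewrite ltr0n.
have eta0 : 0 < eta by rewrite divr_gt0// invr_gt0 mulr_gt0.
have eta_gs : (size gs).+1%:R * (2 * eta) = 1 / 2.
  by rewrite /eta; field; rewrite gt_eqF.
have eta2 : eta <= 1 / 2.
  have : 1 <= (size gs).+1%:R :> R by rewrite ler1n.
  by move: eta_gs; nra.
pose k : R := (size s).+1%:R.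
have k0 : 0 < k by rewrite ltr0n.
pose c := (2 * k)^-1; have c0 : 0 < c by rewrite invr_gt0 mulr_gt0.
have kc : k * c = 1 / 2 by rewrite /c; field; rewrite gt_eqF.
(* Points at Hamming distance less than [tau * N] have images at squared distance less than
   [12 * tau = e ^+ 2]. *)
pose tau := e ^+ 2 / 12; have tau0 : 0 < tau by rewrite divr_gt0 ?exprn_gt0.
(* With this [N], [2 * N <= c * (tau * N) ^+ 2 * eta], so Hamming concentration makes the far set of
   mean at most [eta]. *)
pose N := (Num.truncn (2 / (c * tau ^+ 2 * eta))).+1.
have N0 : 0 < N%:R :> R by rewrite ltr0n.
have NE : 2 < N%:R * (c * tau ^+ 2 * eta).
  rewrite -ltr_pdivrMr ?truncnS_gt// !mulr_gt0//.
pose t : R := (2 * N%:R)^-1; have t0 : 0 < t by rewrite invr_gt0 mulr_gt0.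
(* The mean defect is at most [eta * t ^+ 2], so by Markov's inequality it exceeds [t ^+ 2] only on
   a set of mean at most [eta]. *)
have [es [esN es1 esd]] := exists_almost_orthogonal N infH
  (mulr_gt0 eta0 (exprn_gt0 2 t0)).
pose Bad := [set h : seq G | t ^+ 2 < gram_defect (translates es h)].
have bad_le : imean m N \1_Bad <= eta.
  have := @imean_markov _ _ _ mP N (fun h => gram_defect (translates es h)) Bad
    (t ^+ 2).
  rewrite -{1}esN => /(_ (bdd_gram_defect es1)) H1.
  have t2 : 0 < t ^+ 2 by rewrite exprn_gt0.
  rewrite -(ler_pM2l t2) mulrC [leRHS]mulrC (le_trans _ esd)// mulrC H1//.
    by move=> h _; exact: gram_defect_ge0.
  by move=> h _ /ltW.
pose S h := \sum_(u <- translates es h) u.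
pose X h := (rnorm (S h))^-1%:C *: S h.
(* Preimages are cut down to good points because comparing two values of [X] requires a small Gram
   defect at both. *)
pose A' A := [set h | ~ Bad h /\ exists2 y : unit_sphere H, A y & val y = X h].
have XS h : size h = N -> ~ Bad h -> exists y : unit_sphere H, val y = X h.
  move=> hN /negP; rewrite -leNgt => hgood.
  have := @rnorm_sum_translates_ge es h; rewrite esN => /(_ hN es1 hgood) big.
  have S0 : rnorm (S h) != 0.
    by apply: contraTneq big => ->; rewrite expr0n/= -ltNge divr_gt0.
  have X1 : `|X h| == 1.
    rewrite normrZ (rnormE (S h)) ger0_norm ?ler0c ?invr_ge0 ?rnorm_ge0//.
    by rewrite -rmorphM mulVf// rmorph1.
  by exists (Sub (X h) X1).
(* Pigeonhole: otherwise [Bad] and all the preimages have total mean below [1 / 2 + 1 / 2], although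
   every list of size [N] lies in one of them. The index [None] stands for [Bad]. *)
have [A As cA] : exists2 A, A \in s & c <= imean m N \1_(A' A).
  apply: contrapT => nA.
  have := @imean_union N _ (None :: map Some s) (fun o => if o is Some A then A' A else Bad).
  rewrite big_cons big_map => -[|h hN hA].
    have : \sum_(A <- s) imean m N \1_(A' A) <= (size s)%:R * c.
      rewrite -sum1_size natr_sum mulr_suml [leLHS]big_seq [leRHS]big_seq.
      apply: ler_sum => A As; rewrite mul1r leNgt; apply/negP => lt.
      by apply: nA; exists A => //; exact: ltW.
    by move: kc; rewrite /k -natr1; lra.
  have hgood : ~ Bad h by exact: (hA None (mem_head _ _)).
  have [y yh] := XS _ hN hgood; have [A As Ay] := cov y.
  apply: (hA (Some A)); first by rewrite inE (mem_map Some_inj) As orbT.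
  by split => //; exists y.
exists A => //.
pose Far := [set h | forall h', A' A h' -> size h' = N ->
    tau * N%:R <= (hamming h h')%:R].
have far_le : imean m N \1_Far <= eta.
  have := hamming_concentration mP c0 (mulr_gt0 tau0 N0) cA; rewrite -/Far => le.
  have D0 : 0 < c * (tau * N%:R) ^+ 2 by rewrite !mulr_gt0// exprn_gt0// mulr_gt0.
  rewrite -(ler_pM2l D0) (le_trans le)//.
  have := ler_wpM2r (ltW N0) (ltW NE).
  by rewrite (_ : N%:R * _ * _ = c * (tau * N%:R) ^+ 2 * eta)//; ring.
(* By invariance each [B g] has mean at most [2 * eta]. The unit is added to [gs] so that [h] itself
   is good and [X h] is a point of the sphere. *)
pose B g := [set h | (Bad `|` Far) (map (fun x => g^-1 * x)%g h)].
have [h hN hB] : exists2 h, size h = N & forall g, g \in 1%g :: gs -> ~ B g h.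
  apply: imean_union; apply: (@le_lt_trans _ _ ((size gs).+1%:R * (2 * eta))).
    rewrite -[X in X%:R * _]/(size (1%g :: gs)) -sum1_size natr_sum mulr_suml.
    apply: ler_sum => g _; rewrite mul1r mulr_natl mulr2n.
    rewrite (@eq_imean _ _ _ _ _
      (fun h => \1_(Bad `|` Far) (map (fun x => g^-1 * x)%g h)))//.
    rewrite imean_translate//; last exact: bdd_indic.
    by rewrite (le_trans (imean_indicU mP _ _ _))// lerD.
  by rewrite eta_gs; lra.
have [|x xh] := XS h hN.
  have := hB 1%g (mem_head _ _); rewrite /B/= (_ : map _ h = h).
    by move=> nh hbad; apply: nh; left.
  by rewrite -[RHS]map_id; apply: eq_map => a; rewrite invg1 mul1g.
exists x => g ggs.
have := hB g; rewrite inE ggs orbT => /(_ isT); rewrite /B/=.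
set h' := map _ h => /not_orP[/negP + nfar]; rewrite -leNgt => h'good.
have h'N : size h' = N by rewrite size_map.
have [l [[/negP + [y Ay yl]] lN lh']] : exists l, [/\ A' A l, size l = N &
    (hamming h' l)%:R < tau * N%:R].
  apply: contrapT => nl; apply: nfar => l A'l lN; rewrite leNgt; apply/negP => lt.
  by apply: nl; exists l.
rewrite -leNgt => lgood; exists y => //.
have -> : pi g^-1%g (val x) = X h'.
  have Sh' : S h' = pi g^-1%g (S h).
    by rewrite /S translates_mulg big_map linear_sum.
  by rewrite xh /X Sh' /rnorm urep_norm linearZ.
rewrite yl; have := @normalized_translates_close es l h'.
rewrite esN => /(_ lN h'N es1 lgood h'good); rewrite -/(X l) -/(X h').
rewrite hamming_sym => close.
rewrite -ltr_sqr ?nnegrE ?rnorm_ge0 ?(ltW e0)// -(ltr_pM2l N0).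
rewrite (le_lt_trans close)//.
have := lh'; rewrite /tau; lra.
Qed.

End AmenableConcentration.

Lemma unit_sphere_entourage (R : realType) (H : hilbertSpace R)
    (V : set (unit_sphere H * unit_sphere H)) : entourage V ->
  exists2 e : R, 0 < e &
    forall x y : unit_sphere H, rnorm (val x - val y) < e -> V (x, y).
Proof.
move=> [W entW WV]; move: entW; rewrite -entourage_ballE => -[e /= e0 eW].
have eR : e = (complex.Re e)%:C%C by rewrite RRe_real// gtr0_real.
exists (complex.Re e); first by rewrite -ltcR -eR.
move=> x y xy; apply: WV; apply: eW => /=.
by rewrite -ball_normE /= rnormE eR ltcR.
Qed.

Lemma entourage_unit_sphere (R : realType) (H : hilbertSpace R) (e : R) : 0 < e ->
  entourage [set xy : unit_sphere H * unit_sphere H |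
             rnorm (val xy.1 - val xy.2) < e].
Proof.
move=> e0; exists [set xy : H * H | ball xy.1 e%:C%C xy.2].
  by rewrite -entourage_ballE; exists e%:C%C => //=; rewrite ltcR.
by move=> [x y] /=; rewrite -ball_normE /= rnormE ltcR.
Qed.

(** If every piece failed, each for its own tolerance and finite list of group elements, then the
    least tolerance and the concatenated list would defeat all pieces at once, against
    [finite_cover_concentration]. *)
Lemma amenable_concentration (R : realType) (G : groupType)
    (H : hilbertSpace R) (pi : unitary_rep G H) : amenable R G ->
  infinite_dimensional H -> concentration_property (sphere_action pi).
Proof.
move=> [m mP] infH gamma /finite_seqP[s ->] cov.
pose bad (A : set (unit_sphere H)) (e : R) (gs : seq G) := 
  forall x : unit_sphere H, ~ forall g, g \in gs ->
    exists2 y, A y & rnorm (val y - pi g^-1%g (val x)) < e.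
apply: contrapT => nA.
have badA A : A \in s -> exists e gs, 0 < e /\ bad A e gs.
  move=> As; apply: contrapT => nbad; apply: nA; exists A => // V entV n g.
  have [e e0 eV] := unit_sphere_entourage entV.
  apply: contrapT => n0; apply: nbad.
  exists e, [seq g i | i <- enum 'I_n.+1]; split => // x xg; apply: n0.
  exists x => i _; have [y Ay yx] := xg _ (map_f g (mem_enum _ i)).
  exists (sphere_act pi (g i)^-1%g x); last first.
    by rewrite /= -sphere_actM mulgV sphere_act1.
  by exists y => //; exact: eV.
have [e [gs [e0 egs]]] : exists e gs, 0 < e /\ forall A, A \in s -> bad A e gs.
  elim: (s) badA => [|A r IH] badr.
    by exists 1, [::]; split.
  have [B Br|e [gs [e0 egs]]] := IH; first by apply: badr; rewrite inE Br orbT.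
  have [d [ks [d0 dA]]] := badr A (mem_head _ _).
  exists (Num.min e d), (gs ++ ks); split; first by rewrite lt_min e0 d0.
  move=> B; rewrite inE => /predU1P[->|Br] x xB; [apply: (dA x)|apply: (egs B Br x)];
    move=> g gks; have [|y By] := xB g; rewrite ?mem_cat ?gks ?orbT//;
    by rewrite lt_min => /andP[]; exists y.
have [x|A As [x Ax]] := finite_cover_concentration mP pi (s := s) gs infH e0.
  by have : [set: unit_sphere H] x by []; rewrite -cov => -[A As Ax]; exists A.
exact: egs Ax.
Qed.

(** * Unconditional sums and square-summable functions *)

#[local] Existing Instance totally_filter.

Section UnconditionalSum.
Variables (R : realType) (T : choiceType).
Implicit Types (f g : T -> R) (A : {fset T}) (b c : R).

Definition psum f A : R := \sum_(i <- A) f i.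
(** Convergence along the finite subsets directed by inclusion: no enumeration of [T] is chosen, so
    [T] may be uncountable and bijections preserve sums. *)
Definition unconditional f := cvg (psum f A @[A --> totally]).
Definition rsum f : R := lim (psum f A @[A --> totally]).
Definition psum_le f b := forall A, psum f A <= b.

Lemma psum_lin c f g A : psum (fun i => c * f i + g i) A = c * psum f A + psum g A.
Proof. by rewrite /psum big_split/= mulr_sumr. Qed.

Lemma psum_subset f A B : (forall i, 0 <= f i) -> fsubset A B ->
  psum f A <= psum f B.
Proof.
move=> f0 AB; rewrite /psum [leRHS](big_fsetID _ (mem A))/=.
rewrite (_ : [fset x in B | x \in A]%fset = A).
  by rewrite lerDl sumr_ge0.
apply/fsetP => x; rewrite !inE/=.
by apply/idP/idP => [/andP[]//|xA]; rewrite xA (fsubsetP AB).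
Qed.

Lemma psum_ler f g A : (forall i, f i <= g i) -> psum f A <= psum g A.
Proof. by move=> fg; apply: ler_sum. Qed.

Lemma nonneg_unconditional f b : (forall i, 0 <= f i) -> psum_le f b ->
  unconditional f.
Proof.
move=> f0 fb; pose E := range (psum f).
have E0 : has_sup E.
  split; first by exists (psum f fset0); exists fset0.
  by exists b => _ [A _ <-].
apply/cvg_ex; exists (sup E); apply/cvgrPdist_le => /= e e0.
have [_ [A _ <-] Ae] := sup_adherent e0 E0.
exists A => // B /= AB; rewrite ger0_norm ?subr_ge0.
  by rewrite lerBlDl -lerBlDr (le_trans (ltW Ae))// psum_subset.
by apply: ub_le_sup; [exact: E0.2|exists B].
Qed.

Lemma cvg_rsum f : unconditional f -> psum f A @[A --> totally] --> rsum f.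
Proof. by []. Qed.

Lemma rsum_eq f b : psum f A @[A --> totally] --> b -> rsum f = b.
Proof. exact: cvg_lim. Qed.

Lemma cvg_psum_lin c f g a b : psum f A @[A --> totally] --> a ->
  psum g A @[A --> totally] --> b ->
  psum (fun i => c * f i + g i) A @[A --> totally] --> c * a + b.
Proof.
move=> fa gb; rewrite (_ : psum _ = fun A => c * psum f A + psum g A).
  by apply: cvgD => //; apply: cvgM => //; exact: cvg_cst.
by apply/funext => A; rewrite psum_lin.
Qed.

Lemma unconditional_lin c f g : unconditional f -> unconditional g ->
  unconditional (fun i => c * f i + g i).
Proof.
by move=> /cvg_rsum uf /cvg_rsum ug; apply/cvg_ex; eexists; exact: cvg_psum_lin uf ug.
Qed.

Lemma rsum_lin c f g : unconditional f -> unconditional g ->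
  rsum (fun i => c * f i + g i) = c * rsum f + rsum g.
Proof. by move=> uf ug; apply: rsum_eq; exact: cvg_psum_lin. Qed.

Lemma rsum0 : rsum (fun=> 0) = 0.
Proof.
apply: rsum_eq; rewrite (_ : psum _ = fun=> 0); first exact: cvg_cst.
by apply/funext => A; rewrite /psum big1.
Qed.

Lemma unconditional0 : unconditional (fun=> 0).
Proof. by apply: (@nonneg_unconditional _ 0) => // A; rewrite /psum big1. Qed.

Lemma unconditionalZ c f : unconditional f -> unconditional (fun i => c * f i).
Proof.
move=> uf; have := @unconditional_lin c _ _ uf unconditional0.
by under eq_fun do rewrite addr0.
Qed.

Lemma rsumZ c f : unconditional f -> rsum (fun i => c * f i) = c * rsum f.
Proof.
move=> uf; have := @rsum_lin c _ _ uf unconditional0.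
by under eq_fun do rewrite addr0; rewrite rsum0 addr0.
Qed.

Lemma unconditionalD f g : unconditional f -> unconditional g ->
  unconditional (fun i => f i + g i).
Proof.
move=> uf ug; have := @unconditional_lin 1 _ _ uf ug.
by under eq_fun do rewrite mul1r.
Qed.

Lemma rsumD f g : unconditional f -> unconditional g ->
  rsum (fun i => f i + g i) = rsum f + rsum g.
Proof.
move=> uf ug; rewrite -[X in X + _]mul1r -rsum_lin//.
by under [in RHS]eq_fun do rewrite mul1r.
Qed.

(** Write [f] as [(f + g) - g]: both functions are nonnegative, and [f + g <= 2 * g] keeps the
    partial sums bounded. *)
Lemma dominated_unconditional f g b : (forall i, `|f i| <= g i) ->
  psum_le g b -> unconditional f.
Proof.
move=> fg gb; have g0 i : 0 <= g i by exact: le_trans (fg i).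
have ug : unconditional g by exact: nonneg_unconditional gb.
have ufg : unconditional (fun i => f i + g i).
  apply: (@nonneg_unconditional _ (2 * b)) => [i|A].
    by have := fg i; rewrite ler_norml => /andP[]; lra.
  apply: (@le_trans _ _ (psum (fun i => 1 * g i + g i) A)).
    by apply: psum_ler => i; have := fg i; rewrite ler_norml => /andP[]; lra.
  by rewrite psum_lin; have := gb A; lra.
have := @unconditional_lin (-1) _ _ ug ufg; congr unconditional.
by apply/funext => i; ring.
Qed.

Lemma rsum_le f g : unconditional f -> unconditional g ->
  (forall i, f i <= g i) -> rsum f <= rsum g.
Proof.
move=> uf ug fg; rewrite -subr_ge0 addrC -mulN1r -rsum_lin//.
apply: limr_ge; first exact: unconditional_lin.
by near=> A; apply: sumr_ge0 => i _; have := fg i; lra.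
Unshelve. all: by end_near. Qed.

Lemma rsum_le_bound f b : unconditional f -> psum_le f b -> rsum f <= b.
Proof. by move=> uf fb; apply: limr_le => //; near=> A; exact: fb.
Unshelve. all: by end_near. Qed.

Lemma psum_le_rsum f : unconditional f -> (forall i, 0 <= f i) ->
  psum_le f (rsum f).
Proof.
move=> uf f0 A; apply: limr_ge => //.
by exists A => // B AB; exact: psum_subset.
Qed.

(** Taking images under [s] permutes the finite subsets; those whose image contains [A] are the ones
    containing the image of [A] under the inverse. *)
Lemma rsum_reindex (s : T -> T) f : bijective s -> unconditional f ->
  unconditional (f \o s) /\ rsum (f \o s) = rsum f.
Proof.
move=> [s' sK s'K] /cvg_rsum uf.
suff lim : psum (f \o s) A @[A --> totally] --> rsum f.
  by split; [apply/cvg_ex; exists (rsum f)|exact: rsum_eq].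
rewrite (_ : psum _ = psum f \o (fun A => [fset s x | x in A]%fset)).
  apply: cvg_comp uf => P [A _ AP]; exists [fset s' x | x in A]%fset => // B /= AB.
  apply: AP => /=; apply/fsubsetP => x xA; apply/imfsetP; exists (s' x) => //.
  by apply: (fsubsetP AB); apply/imfsetP; exists x.
apply/funext => A; rewrite /= /psum big_imfset//= => x y _ _.
exact: (can_inj sK).
Qed.

End UnconditionalSum.

(** * Square-summable complex functions *)

Section SquareSummable.
Local Open Scope complex_scope.
Variables (R : realType) (T : choiceType).
Implicit Types (f g : T -> R[i]) (z w v : R[i]).

Definition nsq z : R := complex.Re z ^+ 2 + complex.Im z ^+ 2.
(** With [im_prod], the real and imaginary parts of [z] times the conjugate of [w]; all series thus
    remain real. *)
Definition re_prod z w : R :=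
  complex.Re z * complex.Re w + complex.Im z * complex.Im w.
Definition im_prod z w : R :=
  complex.Im z * complex.Re w - complex.Re z * complex.Im w.

Lemma nsq_ge0 z : 0 <= nsq z.
Proof. by rewrite addr_ge0 ?sqr_ge0. Qed.

Lemma nsqM z w : nsq (z * w) = nsq z * nsq w.
Proof. by case: z w => [a b] [c d]; rewrite /nsq/=; ring. Qed.

Lemma nsqD z w : nsq (z + w) = nsq z + 2 * re_prod z w + nsq w.
Proof. by case: z w => [a b] [c d]; rewrite /nsq/re_prod/=; ring. Qed.

Lemma nsqD_le z w : nsq (z + w) <= 2 * nsq z + 2 * nsq w.
Proof.
case: z w => [a b] [c d]; rewrite /nsq/=.
by have := sqr_ge0 (a - c); have := sqr_ge0 (b - d); lra.
Qed.

Lemma re_prod_le z w : `|re_prod z w| <= nsq z + nsq w.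
Proof.
case: z w => [a b] [c d]; rewrite /nsq/re_prod/= ler_norml.
have := sqr_ge0 (a - c); have := sqr_ge0 (b - d).
have := sqr_ge0 (a + c); have := sqr_ge0 (b + d).
have := sqr_ge0 a; have := sqr_ge0 b; have := sqr_ge0 c; have := sqr_ge0 d.
by move=> *; apply/andP; split; lra.
Qed.

Lemma im_prod_le z w : `|im_prod z w| <= nsq z + nsq w.
Proof.
case: z w => [a b] [c d]; rewrite /nsq/im_prod/= ler_norml.
have := sqr_ge0 (a - d); have := sqr_ge0 (b - c).
have := sqr_ge0 (a + d); have := sqr_ge0 (b + c).
have := sqr_ge0 a; have := sqr_ge0 b; have := sqr_ge0 c; have := sqr_ge0 d.
by move=> *; apply/andP; split; lra.
Qed.

Definition square_summable f := exists b, psum_le (nsq \o f) b.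

Lemma square_summable_nsq f : square_summable f -> unconditional (nsq \o f).
Proof.
by move=> [b fb]; apply: nonneg_unconditional fb => i; exact: nsq_ge0.
Qed.

Lemma square_summable_dominated f g (h : R[i] -> R[i] -> R) :
  (forall z w, `|h z w| <= nsq z + nsq w) ->
  square_summable f -> square_summable g ->
  unconditional (fun i => h (f i) (g i)).
Proof.
move=> hle [b fb] [c gc].
apply: (@dominated_unconditional _ _ _ (fun i => 1 * nsq (f i) + nsq (g i)) (b + c)).
  by move=> i; rewrite mul1r.
by move=> A; rewrite psum_lin mul1r lerD ?fb ?gc.
Qed.

Lemma square_summable_lin z f g : square_summable f -> square_summable g ->
  square_summable (z *: f + g).
Proof.
move=> [b fb] [c gc]; exists (2 * nsq z * b + 2 * c) => A.
apply: (@le_trans _ _ (psum (fun i => (2 * nsq z) * nsq (f i) + 2 * nsq (g i)) A)).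
  by apply: psum_ler => i; rewrite /= (le_trans (nsqD_le _ _))// nsqM mulrA.
rewrite psum_lin lerD//.
  by apply: ler_wpM2l; [rewrite mulr_ge0 ?nsq_ge0|exact: fb].
by rewrite /psum -mulr_sumr; apply: ler_wpM2l => //; exact: gc.
Qed.

Lemma square_summable0 : square_summable 0.
Proof.
by exists 0 => A; rewrite /psum big1// => i _; rewrite /nsq/= !expr0n addr0.
Qed.

Definition ell2_pred : {pred T -> R[i]} := fun f => `[< square_summable f >].

Lemma ell2_submod_closed : submod_closed ell2_pred.
Proof.
split; first by apply/asboolP; exact: square_summable0.
by move=> z f g /asboolP fs /asboolP gs; apply/asboolP; exact: square_summable_lin.
Qed.

End SquareSummable.

HB.instance Definition _ (R : realType) (T : choiceType) :=
  GRing.isSubmodClosed.Build R[i]%C (T -> R[i]%C) (@ell2_pred R T)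
    (@ell2_submod_closed R T).

Record ell2 (R : realType) (T : choiceType) := Ell2 {
  ell2_fun :> T -> R[i]%C;
  ell2_funP : ell2_fun \in @ell2_pred R T }.

HB.instance Definition _ (R : realType) (T : choiceType) :=
  [isSub for @ell2_fun R T].
HB.instance Definition _ (R : realType) (T : choiceType) :=
  [Choice of ell2 R T by <:].
HB.instance Definition _ (R : realType) (T : choiceType) :=
  [SubChoice_isSubLmodule of ell2 R T by <:].

Section Ell2Norm.
Local Open Scope complex_scope.
Variables (R : realType) (T : choiceType).
Notation E := (ell2 R T).
Implicit Types (f g h : E) (z : R[i]).

Lemma ell2_summable f : square_summable f.
Proof. by apply/asboolP; exact: ell2_funP. Qed.

Lemma ell2D f g i : (f + g) i = f i + g i.
Proof. by []. Qed.

Lemma ell2B f g i : (f - g) i = f i - g i.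
Proof. by []. Qed.

Lemma ell2Z z f i : (z *: f) i = z * f i.
Proof. by []. Qed.

Definition re_inner f g : R := rsum (fun i => re_prod (f i) (g i)).
Definition im_inner f g : R := rsum (fun i => im_prod (f i) (g i)).
Definition sq_norm f : R := rsum (fun i => nsq (f i)).

Lemma unconditional_nsq f : unconditional (fun i => nsq (f i)).
Proof. exact: square_summable_nsq (ell2_summable f). Qed.

Lemma unconditional_re f g : unconditional (fun i => re_prod (f i) (g i)).
Proof.
by apply: square_summable_dominated; [exact: re_prod_le| |]; exact: ell2_summable.
Qed.

Lemma unconditional_im f g : unconditional (fun i => im_prod (f i) (g i)).
Proof.
by apply: square_summable_dominated; [exact: im_prod_le| |]; exact: ell2_summable.
Qed.

Lemma re_inner_lin z f g h : re_inner (z *: f + g) h =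
  complex.Re z * re_inner f h - complex.Im z * im_inner f h + re_inner g h.
Proof.
rewrite -addrA -[X in _ + (X + _)]mulNr -rsum_lin; last 2 first.
  exact: unconditional_im.
  exact: unconditional_re.
rewrite -rsum_lin; last 2 first.
  exact: unconditional_re.
  by apply: unconditional_lin; [exact: unconditional_im|exact: unconditional_re].
congr rsum; apply/funext => i; rewrite ell2D ell2Z.
by case: z (f i) (g i) (h i) => [a b] [c d] [e k] [l n]; rewrite /re_prod/im_prod/=; ring.
Qed.

Lemma im_inner_lin z f g h : im_inner (z *: f + g) h =
  complex.Re z * im_inner f h + complex.Im z * re_inner f h + im_inner g h.
Proof.
rewrite -addrA -rsum_lin; last 2 first.
  exact: unconditional_re.
  exact: unconditional_im.
rewrite -rsum_lin; last 2 first.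
  exact: unconditional_im.
  by apply: unconditional_lin; [exact: unconditional_re|exact: unconditional_im].
congr rsum; apply/funext => i; rewrite ell2D ell2Z.
by case: z (f i) (g i) (h i) => [a b] [c d] [e k] [l n]; rewrite /re_prod/im_prod/=; ring.
Qed.

Lemma re_innerC f g : re_inner f g = re_inner g f.
Proof. by congr rsum; apply/funext => i; rewrite /re_prod; ring. Qed.

Lemma im_innerC f g : im_inner f g = - im_inner g f.
Proof.
rewrite -mulN1r -rsumZ; last exact: unconditional_im.
by congr rsum; apply/funext => i; rewrite /im_prod; ring.
Qed.

Lemma re_innerff f : re_inner f f = sq_norm f.
Proof. by congr rsum; apply/funext => i; rewrite /re_prod/nsq; ring. Qed.

Lemma im_innerff f : im_inner f f = 0.
Proof. by have := im_innerC f f; lra. Qed.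

Lemma nsq_le_sq_norm f i : nsq (f i) <= sq_norm f.
Proof.
have := psum_le_rsum (@unconditional_nsq f) (fun i => nsq_ge0 (f i)) [fset i]%fset.
by rewrite /psum big_seq_fset1.
Qed.

Lemma psum_le_sq_norm f : psum_le (fun i => nsq (f i)) (sq_norm f).
Proof. by apply: psum_le_rsum (@unconditional_nsq f) _ => i; exact: nsq_ge0. Qed.

Lemma sq_norm_ge0 f : 0 <= sq_norm f.
Proof. by have := psum_le_sq_norm f fset0; rewrite /psum big_seq_fset0. Qed.

Lemma sq_norm_eq0 f : sq_norm f = 0 -> f = 0.
Proof.
move=> f0; apply: val_inj; apply/funext => i /=; have := nsq_le_sq_norm f i.
rewrite f0 => le0; have : nsq (f i) == 0 by rewrite eq_le le0 nsq_ge0.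
case: (f i) => [a b]; rewrite /nsq/= paddr_eq0 ?sqr_ge0// !sqrf_eq0.
by move=> /andP[/eqP-> /eqP->].
Qed.

Lemma sq_normZ z f : sq_norm (z *: f) = nsq z * sq_norm f.
Proof.
rewrite -rsumZ; last exact: unconditional_nsq.
by congr rsum; apply/funext => i; rewrite ell2Z nsqM.
Qed.

Lemma sq_normD f g : sq_norm (f + g) = sq_norm f + 2 * re_inner f g + sq_norm g.
Proof.
rewrite -rsumZ; last exact: unconditional_re.
rewrite -rsumD; [|exact: unconditional_nsq|exact/unconditionalZ/unconditional_re].
rewrite -rsumD; last 2 first.
- by apply: unconditionalD; [exact: unconditional_nsq|exact/unconditionalZ/unconditional_re].
- exact: unconditional_nsq.
by congr rsum; apply/funext => i; rewrite ell2D nsqD.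
Qed.

Definition ell2_norm f : R := Num.sqrt (sq_norm f).

Lemma sqr_ell2_norm f : ell2_norm f ^+ 2 = sq_norm f.
Proof. by rewrite sqr_sqrtr ?sq_norm_ge0. Qed.

Lemma ell2_norm_ge0 f : 0 <= ell2_norm f.
Proof. exact: sqrtr_ge0. Qed.

Lemma ell2_norm_eq0 f : ell2_norm f = 0 -> f = 0.
Proof. by move=> f0; apply: sq_norm_eq0; rewrite -sqr_ell2_norm f0 expr0n. Qed.

Lemma ell2_normZ z f : ell2_norm (z *: f) = Num.sqrt (nsq z) * ell2_norm f.
Proof. by rewrite /ell2_norm sq_normZ sqrtrM ?nsq_ge0. Qed.

Lemma re_inner_le f g : re_inner f g <= ell2_norm f * ell2_norm g.
Proof.
set a := ell2_norm f; set b := ell2_norm g.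
have a0 : 0 <= a by exact: ell2_norm_ge0.
have b0 : 0 <= b by exact: ell2_norm_ge0.
have re0 h : re_inner 0 h = 0.
  by rewrite /re_inner (_ : (fun _ => _) = fun=> 0) ?rsum0//; apply/funext => i;
    rewrite /re_prod/= !mul0r addr0.
have [a_eq0|a_neq0] := eqVneq a 0.
  by rewrite (ell2_norm_eq0 a_eq0) re0 mulr_ge0.
have [b_eq0|b_neq0] := eqVneq b 0.
  by rewrite (ell2_norm_eq0 b_eq0) re_innerC re0 mulr_ge0.
have ab : 0 < a * b by rewrite mulr_gt0// lt_neqAle eq_sym ?a_neq0 ?b_neq0.
rewrite -(ler_pM2l (mulr_gt0 (ltr0n R 2) ab)).
(* In this form Cauchy-Schwarz holds term by term, by expanding the squared modulus of
   [b * f i - a * g i]. *)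
have -> : 2 * (a * b) * (a * b) = b ^+ 2 * sq_norm f + a ^+ 2 * sq_norm g.
  by rewrite -(sqr_ell2_norm f) -(sqr_ell2_norm g) -/a -/b; ring.
rewrite -(rsumZ _ (@unconditional_re _ _)).
rewrite -(rsumZ (a ^+ 2) (@unconditional_nsq _)) -rsum_lin; last 2 first.
- exact: unconditional_nsq.
- exact/unconditionalZ/unconditional_nsq.
apply: rsum_le.
- exact/unconditionalZ/unconditional_re.
- by apply: unconditional_lin; [|apply: unconditionalZ]; exact: unconditional_nsq.
move=> i; case: (f i) (g i) => [x y] [u v]; rewrite /re_prod/nsq/=.
by have := sqr_ge0 (b * x - a * u); have := sqr_ge0 (b * y - a * v); lra.
Qed.

Lemma ell2_normD f g : ell2_norm (f + g) <= ell2_norm f + ell2_norm g.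
Proof.
rewrite -ler_sqr ?nnegrE ?addr_ge0 ?ell2_norm_ge0// sqr_ell2_norm sq_normD.
by rewrite sqrrD !sqr_ell2_norm lerD2r lerD2l mulr_natl ler_wMn2r// re_inner_le.
Qed.

End Ell2Norm.

Lemma sqrt_nsq (R : realType) (z : R[i]%C) : (Num.sqrt (nsq z))%:C%C = `|z|.
Proof. by rewrite normc_def. Qed.

Lemma nsqB (R : realType) (z w : R[i]%C) : nsq (z - w) =
  (complex.Re z - complex.Re w) * (complex.Re z - complex.Re w) +
  (complex.Im z - complex.Im w) * (complex.Im z - complex.Im w).
Proof. by case: z w => [a b] [c d]; rewrite /nsq/=; ring. Qed.

(** * The Hilbert space structure on square-summable functions *)

Section Ell2Normed.
Variables (R : realType) (T : choiceType).
Notation E := (ell2 R T).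

Lemma ell2_normc_triangle (f g : E) :
  (ell2_norm (f + g))%:C%C <= (ell2_norm f)%:C%C + (ell2_norm g)%:C%C.
Proof. by rewrite -rmorphD lecR ell2_normD. Qed.

Lemma ell2_normcZ (z : R[i]%C) (f : E) :
  (ell2_norm (z *: f))%:C%C = `|z| * (ell2_norm f)%:C%C.
Proof. by rewrite ell2_normZ -sqrt_nsq -rmorphM. Qed.

Lemma ell2_normc_eq0 (f : E) : (ell2_norm f)%:C%C = 0 -> f = 0.
Proof. by move=> /complexI; exact: ell2_norm_eq0. Qed.

HB.instance Definition _ := Lmodule_isNormed.Build R[i]%C E
  ell2_normc_triangle ell2_normcZ ell2_normc_eq0.

Lemma ell2_normE (f : E) : `|f| = (ell2_norm f)%:C%C.
Proof. by []. Qed.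

Lemma ell2_ballE (f g : E) (e : R) :
  ball f e%:C%C g = (ell2_norm (f - g) < e) :> Prop.
Proof. by rewrite -ball_normE /= ell2_normE ltcR. Qed.

Lemma ell2_complete (F : set_system E) : ProperFilter F -> cauchy F -> cvg F.
Proof.
move=> FF Fc.
have Fe (e : R) : 0 < e -> exists f : E, \forall g \near F, ell2_norm (f - g) < e.
  move=> e0; have /cauchyP/(_ e%:C%C)[|f Ff] := Fc; first by rewrite ltcR.
  by exists f; apply: filterS Ff => g; rewrite /= ell2_ballE.
(* Evaluation at a point followed by [p] is 1-Lipschitz, so it carries [F] to a Cauchy filter on the
   reals; [p] will be the real and the imaginary part. *)
have coord (p : R[i]%C -> R) : {morph p : z w / z - w} ->
    (forall z, p z ^+ 2 <= nsq z) ->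
    forall i, cvg (p (f i) @[f --> F]).
  move=> pB ple i; apply/cauchy_cvgP/cauchy_exP => e e0.
  have [f Ff] := Fe e e0; exists (p (f i)); rewrite /= nbhs_simpl /=.
  apply: filterS Ff => g fg; rewrite /= -ball_normE/= -pB.
  rewrite (le_lt_trans _ fg)// -ler_sqr ?nnegrE ?ell2_norm_ge0//.
  rewrite real_normK ?num_real// sqr_ell2_norm.
  by rewrite (le_trans (ple _))// -ell2B nsq_le_sq_norm.
have cre : forall i, cvg (complex.Re (f i) @[f --> F]).
  apply: coord => [[a b] [c d]//|z]; by rewrite /nsq lerDl sqr_ge0.
have cim : forall i, cvg (complex.Im (f i) @[f --> F]).
  apply: coord => [[a b] [c d]//|z]; by rewrite /nsq lerDr sqr_ge0.
pose l i : R[i]%C := Complex (lim (complex.Re (f i) @[f --> F]))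
  (lim (complex.Im (f i) @[f --> F])).
(* Norm bounds pass to the pointwise limit on each finite set, uniformly in that set. This serves
   both to show that [l] is square summable and to obtain convergence in norm. *)
have close (f : E) (e : R) : (\forall g \near F, ell2_norm (f - g) < e) ->
    psum_le (fun i => nsq (f i - l i)) (e ^+ 2).
  move=> fe A.
  have term i : nsq (f i - g i) @[g --> F] --> nsq (f i - l i).
    rewrite nsqB; under eq_fun do rewrite nsqB.
    apply: cvgD.
      by apply: cvgM; (apply: cvgB; [exact: cvg_cst|exact: cre]).
    by apply: cvgM; (apply: cvgB; [exact: cvg_cst|exact: cim]).
  have lim : psum (fun i => nsq (f i - g i)) A @[g --> F] -->
      psum (fun i => nsq (f i - l i)) A.
    by apply: cvg_big => [|i _]; [exact: add_continuous|exact: term].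
  rewrite -(cvg_lim _ lim)//; apply: limr_le; first by apply/cvg_ex; eexists; exact: lim.
  apply: filterS fe => g fg; rewrite (le_trans (psum_le_sq_norm (f - g) A))//.
  rewrite -sqr_ell2_norm ler_sqr ?nnegrE ?ell2_norm_ge0 ?(ltW fg)//.
  by rewrite (le_trans _ (ltW fg))// ell2_norm_ge0.
have lS : l \in @ell2_pred R T.
  have [f Ff] := Fe 1 ltr01.
  have fl : (f : T -> _) - l \in @ell2_pred R T.
    by apply/asboolP; exists (1 ^+ 2); exact: close Ff.
  rewrite (_ : l = (-1) *: ((f : T -> _) - l) + f).
    by rewrite rpredD ?rpredZ ?ell2_funP.
  by rewrite scaleN1r opprB subrK.
pose L : E := Ell2 lS.
have toL (f : E) (e : R) : 0 < e -> (\forall g \near F, ell2_norm (f - g) < e) ->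
    ell2_norm (f - L) <= e.
  move=> e0 fe; rewrite -ler_sqr ?nnegrE ?ell2_norm_ge0 ?(ltW e0)// sqr_ell2_norm.
  by apply: rsum_le_bound; [exact: unconditional_nsq|exact: close fe].
apply/cvg_ex; exists L; apply/cvgrPdist_lt => /= e e0.
have eE : e = (complex.Re e)%:C%C by rewrite RRe_real// gtr0_real.
have d0 : 0 < complex.Re e / 2 by rewrite divr_gt0// -ltcR -eE.
have [f Ff] := Fe _ d0; apply: filterS (Ff) => g fg.
have fL := toL _ _ d0 Ff.
rewrite distrC ell2_normE eE ltcR -(subrK f g) -addrA.
rewrite (le_lt_trans (ell2_normD _ _))//.
have -> : ell2_norm (g - f) = ell2_norm (f - g).
  by apply: complexI; rewrite -!ell2_normE distrC.
by lra.
Qed.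

HB.instance Definition _ := Uniform_isComplete.Build E ell2_complete.

Definition ell2_inner (f g : E) : R[i]%C := Complex (re_inner f g) (im_inner f g).

Lemma ell2_inner_linl (g : E) : scalar (ell2_inner^~ g).
Proof.
move=> z f h; rewrite /ell2_inner re_inner_lin im_inner_lin.
by case: z => a b; apply/eqP; rewrite eq_complex/= !eqxx.
Qed.

Lemma ell2_innerC (f g : E) :
  ell2_inner f g = (-1) ^+ false * Num.conj (ell2_inner g f).
Proof.
rewrite expr0 mul1r /ell2_inner re_innerC im_innerC.
by [].
Qed.

Lemma ell2_inner_linr (f : E) :
  GRing.linear_for (Num.conj \; *%R) (ell2_inner f).
Proof.
move=> z g h; rewrite ell2_innerC (ell2_innerC f g) (ell2_innerC f h).
by rewrite !expr0 !mul1r ell2_inner_linl rmorphD rmorphM.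
Qed.

HB.instance Definition _ := bilinear_isBilinear.Build R[i]%C E E R[i]%C
  *%R (Num.conj \; *%R) ell2_inner (ell2_inner_linl, ell2_inner_linr).

HB.instance Definition _ := isHermitianSesquilinear.Build R[i]%C E false Num.conj
  ell2_inner ell2_innerC.

Lemma ell2_innerff (f : E) : ell2_inner f f = `|f| ^+ 2.
Proof.
by rewrite ell2_normE -rmorphXn sqr_ell2_norm /ell2_inner re_innerff im_innerff.
Qed.

Lemma ell2_inner_gt0 (f : E) : f != 0 -> 0 < ell2_inner f f.
Proof. by move=> f0; rewrite ell2_innerff exprn_gt0// normr_gt0. Qed.

HB.instance Definition _ := isDotProduct.Build R[i]%C E ell2_inner ell2_inner_gt0.

Definition ell2_hilbert : hilbertSpace R := @HilbertSpace R E ell2_inner ell2_innerff.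

End Ell2Normed.

(** * Concentration implies amenability *)

Section TranslationRepresentation.
Variables (R : realType) (G : groupType).
Notation T := (G * nat)%type.
Notation E := (ell2 R T).
Implicit Types (g h : G) (xi zeta : E) (f : G -> R).

Definition shift g (p : T) : T := ((g^-1 * p.1)%g, p.2).

Lemma shift_bij g : bijective (shift g).
Proof.
by exists (shift g^-1%g) => -[a n]; rewrite /shift/= ?invgK ?mulKg ?mulVKg ?mulKVg.
Qed.

Lemma square_summable_shift g xi : (xi \o shift g : T -> R[i]%C) \in @ell2_pred R T.
Proof.
have [u _] := rsum_reindex (shift_bij g) (@unconditional_nsq _ _ xi).
apply/asboolP; eexists; apply: psum_le_rsum; first exact: u.
by move=> i; exact: nsq_ge0.
Qed.

Definition translate g xi : E := Ell2 (square_summable_shift g xi).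

Lemma translate_linear g : linear (translate g).
Proof. by move=> z xi zeta; apply: val_inj. Qed.

HB.instance Definition _ g :=
  GRing.isLinear.Build R[i]%C E E *:%R (translate g) (translate_linear g).

Lemma translate1 xi : translate 1%g xi = xi.
Proof.
apply: val_inj; apply/funext => -[a n] /=.
by rewrite /shift/= invg1 mul1g.
Qed.

Lemma translateM g h xi : translate (g * h)%g xi = translate g (translate h xi).
Proof.
apply: val_inj; apply/funext => -[a n] /=.
by rewrite /shift/= invgM mulgA.
Qed.

Lemma translate_unitary g :
  @unitary R (ell2_hilbert R T) (translate g : {linear E -> E}).
Proof.
split.
  by exists (translate g^-1%g) => xi /=; rewrite -translateM ?mulVg ?mulgV translate1.
move=> xi zeta; apply/eqP; rewrite eq_complex/=; apply/andP; split; apply/eqP.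
  exact: (rsum_reindex (shift_bij g) (@unconditional_re _ _ xi zeta)).2.
exact: (rsum_reindex (shift_bij g) (@unconditional_im _ _ xi zeta)).2.
Qed.

Definition translation_rep : unitary_rep G (ell2_hilbert R T) :=
  @UnitaryRep R G (ell2_hilbert R T) (fun g => translate g : {linear E -> E})
    translate_unitary translate1 translateM.

Definition dirac_fun (q : T) : T -> R[i]%C := fun p => (p == q)%:R.

Lemma square_summable_dirac q : dirac_fun q \in @ell2_pred R T.
Proof.
apply/asboolP; exists 1 => A; rewrite /psum/=.
have [qA|qA] := boolP (q \in A).
  rewrite (big_fsetD1 q)//= big1_fset ?addr0.
    by rewrite /dirac_fun eqxx /nsq/= expr1n expr0n addr0.
  by move=> p; rewrite !inE /dirac_fun => /andP[/negPf-> _] _; rewrite /nsq/= !expr0n addr0.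
rewrite big1_fset// => p pA _; rewrite /dirac_fun.
have /negPf-> : p != q by apply: contraNneq qA => <-.
by rewrite /nsq/= !expr0n addr0.
Qed.

Definition dirac_ell2 q : E := Ell2 (square_summable_dirac q).

Lemma ell2_sumE (I : Type) (r : seq I) (F : I -> E) p :
  (\sum_(i <- r) F i) p = \sum_(i <- r) F i p.
Proof. by elim/big_rec2 : _ => // i y x _ <-. Qed.

(* The factor [nat] keeps the space infinite-dimensional when [G] is finite. *)
Lemma ell2_infinite_dimensional : infinite_dimensional (ell2_hilbert R T).
Proof.
move=> [n [e espan]].
(* If [n] vectors spanned, the coefficients of [n + 1] Dirac functions would form a matrix with more
   rows than columns; a nonzero row vector in its kernel is a linear relation between these
   functions, and evaluating at each point kills it. *)
pose delta (k : 'I_n.+1) : E := dirac_ell2 (1%g, k : nat).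
have [c cE] := choice (fun k => espan (delta k)).
pose C : 'M[R[i]%C]_(n.+1, n) := \matrix_(k, i) c k i.
have : kermx C != 0.
  by rewrite kermx_eq0 /row_free neq_ltn (leq_ltn_trans (rank_leq_col C)).
case/rowV0Pn => u /sub_kermxP uC /eqP; apply; apply/rowP => k.
have u0 : \sum_j u 0 j *: delta j = 0.
  under eq_bigr => j _ do rewrite cE scaler_sumr.
  rewrite exchange_big big1//= => i _.
  under eq_bigr do rewrite scalerA.
  rewrite -scaler_suml.
  have -> : \sum_j u 0 j * c j i = (u *m C) 0 i.
    by rewrite mxE; apply: eq_bigr => j _; rewrite mxE.
  by rewrite uC mxE scale0r.
have /(congr1 (fun xi : E => xi (1%g, k : nat))) := u0.
rewrite ell2_sumE (bigD1 k)// big1 ?addr0; last first.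
  move=> j jk; rewrite ell2Z /= /dirac_fun xpair_eqE eqxx/=.
  by rewrite eq_sym (inj_eq val_inj) (negPf jk) mulr0.
by rewrite ell2Z /= /dirac_fun eqxx mulr1 addr0 mxE => ->.
Qed.

(** For a unit vector [xi], the expectation of [f] under the probability on [G] that is the marginal
    of the squared modulus of [xi]. *)
Definition weighted_sum f xi : R := rsum (fun p : T => f p.1 * nsq (xi p)).

Lemma unconditional_weighted f xi B : (forall x, `|f x| <= B) ->
  unconditional (fun p : T => f p.1 * nsq (xi p)).
Proof.
move=> fB; apply: (@dominated_unconditional _ _ _ (fun p => B * nsq (xi p)) (B * sq_norm xi)).
  by move=> p; rewrite normrM (ger0_norm (nsq_ge0 _)) ler_wpM2r// nsq_ge0.
move=> A; rewrite /psum -mulr_sumr ler_wpM2l//; last exact: psum_le_sq_norm.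
exact: le_trans (fB 1%g).
Qed.

Lemma weighted_sum_translate g f xi B : (forall x, `|f x| <= B) ->
  weighted_sum f (translate g xi) = weighted_sum (fun x => f (g * x)%g) xi.
Proof.
move=> fB; have fgB x : `|f (g * x)%g| <= B by exact: fB.
rewrite /weighted_sum -(rsum_reindex (shift_bij g) (@unconditional_weighted _ xi _ fgB)).2.
by congr rsum; apply/funext => p; rewrite /= mulVKg.
Qed.

Lemma weighted_sum_le f xi B : (forall x, `|f x| <= B) -> sq_norm xi = 1 ->
  `|weighted_sum f xi| <= B.
Proof.
move=> fB xi1; have uf := @unconditional_weighted _ xi _ fB.
have uB : unconditional (fun p : T => B * nsq (xi p)).
  exact/unconditionalZ/unconditional_nsq.
have uNB : unconditional (fun p : T => - B * nsq (xi p)).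
  exact/unconditionalZ/unconditional_nsq.
have sB b : rsum (fun p : T => b * nsq (xi p)) = b.
  by rewrite rsumZ ?[rsum _]xi1 ?mulr1//; exact: unconditional_nsq.
rewrite ler_norml -{1}(sB (- B)) -{2}(sB B); apply/andP; split;
  apply: rsum_le => // p; rewrite ler_wpM2r ?nsq_ge0//;
  by have := fB p.1; rewrite ler_norml => /andP[].
Qed.

(** Termwise, [2 * u * v <= u ^+ 2 / d + d * v ^+ 2] bounds the change of the squared modulus by
    [(1 + 1 / d)] times that of [xi - zeta] plus [d] times that of [zeta]; the sum is at most
    [d ^+ 2 + 2 * d <= 3 * d]. *)
Lemma weighted_sum_lipschitz f xi zeta B d : (forall x, `|f x| <= B) ->
  0 < d <= 1 -> sq_norm zeta = 1 -> ell2_norm (xi - zeta) <= d ->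
  `|weighted_sum f xi - weighted_sum f zeta| <= B * (3 * d).
Proof.
move=> fB /andP[d0 d1] z1 xz; have B0 : 0 <= B by exact: le_trans (fB 1%g).
have uxi := @unconditional_weighted _ xi _ fB.
have uzeta := @unconditional_weighted _ zeta _ fB.
pose k p := B * (1 + d^-1) * nsq ((xi - zeta) p) + B * d * nsq (zeta p).
have uk : unconditional k.
  by apply: unconditional_lin; [|apply: unconditionalZ]; exact: unconditional_nsq.
have kE : rsum k <= B * (3 * d).
  rewrite rsum_lin; last 2 first.
  - exact: unconditional_nsq.
  - exact/unconditionalZ/unconditional_nsq.
  rewrite rsumZ; last exact: unconditional_nsq.
  rewrite -/(sq_norm (xi - zeta)) -/(sq_norm zeta) z1 mulr1 -!mulrA -mulrDr.
  rewrite ler_wpM2l// -sqr_ell2_norm.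
  have : ell2_norm (xi - zeta) ^+ 2 <= d ^+ 2.
    by rewrite ler_sqr ?nnegrE ?ell2_norm_ge0 ?(ltW d0).
  have di : 0 <= 1 + d^-1 by rewrite addr_ge0// invr_ge0 ltW.
  move=> /(ler_wpM2l di) le; rewrite (le_trans (lerD le (lexx d)))//.
  have -> : (1 + d^-1) * d ^+ 2 = d ^+ 2 + d by field; rewrite gt_eqF.
  by nra.
have le p : `|f p.1 * nsq (xi p) - f p.1 * nsq (zeta p)| <= k p.
  rewrite -mulrBr normrM /k -!mulrA -mulrDr ler_pM// ell2B.
  case: (xi p) (zeta p) => [a b] [x y]; rewrite /nsq/=.
  have sq (u v : R) : 2 * (u * v) <= d^-1 * u ^+ 2 + d * v ^+ 2 /\
      - (2 * (u * v)) <= d^-1 * u ^+ 2 + d * v ^+ 2.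
    have E1 : d^-1 * u ^+ 2 + d * v ^+ 2 - 2 * (u * v) = d^-1 * (u - d * v) ^+ 2.
      by field; rewrite gt_eqF.
    have E2 : d^-1 * u ^+ 2 + d * v ^+ 2 + 2 * (u * v) = d^-1 * (u + d * v) ^+ 2.
      by field; rewrite gt_eqF.
    have di : 0 <= d^-1 by rewrite invr_ge0 ltW.
    have := mulr_ge0 di (sqr_ge0 (u - d * v)); have := mulr_ge0 di (sqr_ge0 (u + d * v)).
    by rewrite -E1 -E2; split; lra.
  have [s1 s2] := sq (a - x) x; have [s3 s4] := sq (b - y) y.
  have := sqr_ge0 (a - x); have := sqr_ge0 (b - y).
  by move=> ? ?; rewrite ler_norml; apply/andP; split; lra.
have -> : weighted_sum f xi - weighted_sum f zeta =
    rsum (fun p : T => -1 * (f p.1 * nsq (zeta p)) + f p.1 * nsq (xi p)).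
  by rewrite rsum_lin// mulN1r addrC.
have ud : unconditional (fun p : T => -1 * (f p.1 * nsq (zeta p)) + f p.1 * nsq (xi p)).
  exact: unconditional_lin.
apply: le_trans kE; rewrite ler_norml; apply/andP; split.
  have -> : - rsum k = rsum (fun p => -1 * k p) by rewrite rsumZ// mulN1r.
  apply: rsum_le => //; first exact: unconditionalZ.
  by move=> p; have := le p; rewrite ler_norml => /andP[]; lra.
by apply: rsum_le => // p; have := le p; rewrite ler_norml => /andP[]; lra.
Qed.

End TranslationRepresentation.

(** * Ultrafilters of concentrated sets and the limit mean *)

Definition concentrated (G : groupType) (X : uniformType)
    (a : uniform_action G X) (A : set X) : Prop :=
  forall V : set (X * X), entourage V -> forall (n : nat) (g : 'I_n.+1 -> G),
    \bigcap_(i in [set: 'I_n.+1]) (a (g i) @` entourage_nbhd V A) !=set0.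

(** Complements of non-concentrated sets have the finite intersection property: an empty finite
    intersection would be a finite cover by non-concentrated sets. An ultrafilter containing these
    complements has only concentrated members. *)
Lemma exists_concentrated_ultrafilter (G : groupType) (X : uniformType)
    (a : uniform_action G X) : concentration_property a ->
  exists2 U : set_system X, UltraFilter U & forall A, U A -> concentrated a A.
Proof.
move=> ca; pose D := [set A | ~ concentrated a A].
have finID : finI D (fun A : set X => ~` A).
  move=> D' D'D; apply: contrapT => n0.
  have [||A /= AD' cA] := ca [set` D']; first exact: finite_fset.
    apply/seteqP; split => // x _; apply: contrapT => nx.
    by apply: n0; exists x => A /= AD' Ax; apply: nx; exists A.
  by have := D'D _ AD'; rewrite inE /D /= => /(_ cA).
have [U [UU sU]] := ultraFilterLemma (finI_filter finID).
exists U => // A UA; apply: contrapT => nA.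
have UC : U (~` A).
  apply: sU; exists (~` A) => //; exists [fset A]%fset.
    by move=> B; rewrite inE => /eqP->; rewrite inE.
  by apply/seteqP; split => x /= H; [apply: H; rewrite /= inE|move=> B /=; rewrite inE => /eqP->].
by have [x []] := filter_ex (filterI UA UC).
Qed.

(** Compactness of the segment provides a cluster point, and an ultrafilter converges to each of its
    cluster points. *)
Lemma bounded_ultrafilter_cvg (R : realType) (X : Type) (U : set_system X)
    (h : X -> R) B : UltraFilter U -> (forall x, `|h x| <= B) ->
  cvg (h x @[x --> U]).
Proof.
move=> UU hB; have PF : ProperFilter (h x @[x --> U]) by exact: fmap_proper_filter.
have [|p [_ clp]] := @segment_compact R (- B) B (h x @[x --> U]).
  suff : U (h @^-1` `[- B, B]) by [].
  by apply: filterE => x /=; rewrite in_itv/= -ler_norml hB.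
apply/cvg_ex; exists p => N pN.
have [//|UC] := in_ultra_setVsetC (h @^-1` N) UU.
by have [x [/= nN Nx]] := clp (~` N) N UC pN.
Qed.

Section ConcentrationMean.
Variables (R : realType) (G : groupType).
Notation H := (ell2_hilbert R (G * nat)%type).
Notation act := (sphere_action (translation_rep R G)).
Implicit Types (f : G -> R) (xi : unit_sphere H).

Definition sphere_sum f xi : R := weighted_sum f (val xi : ell2 R (G * nat)%type).

Lemma sq_norm_unit_sphere xi : sq_norm (val xi : ell2 R (G * nat)%type) = 1.
Proof.
have /eqP := valP xi; rewrite ell2_normE => /complexI n1.
by rewrite -sqr_ell2_norm n1 expr1n.
Qed.

Lemma sphere_sum_act g f xi : bounded_fun f ->
  sphere_sum f (act g xi) = sphere_sum (fun x => f (g * x)%g) xi.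
Proof. by move=> /bounded_fun_exP[B fB]; exact: weighted_sum_translate fB. Qed.

Variable U : set_system (unit_sphere H).
Hypothesis UU : UltraFilter U.
Hypothesis Uconc : forall A, U A -> concentrated act A.

Definition limit_mean f : R := lim (sphere_sum f xi @[xi --> U]).

Lemma cvg_limit_mean f : bounded_fun f ->
  sphere_sum f xi @[xi --> U] --> limit_mean f.
Proof.
move=> /bounded_fun_exP[B fB]; apply: (@bounded_ultrafilter_cvg _ _ _ _ B) => // xi.
by apply: weighted_sum_le => //; exact: sq_norm_unit_sphere.
Qed.

(** On some [A] in [U] the averages of [f] and of its translate are near their limits. Concentration
    for [1] and [g] gives [x] near some [z1] in [A] with [g^-1 x] near some [z2] in [A], so the
    translate at [z1], which is [f] at [g^-1 z1], is near [f] at [z2]. *)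
Lemma limit_mean_translate g f : bounded_fun f ->
  limit_mean (fun x => f (g^-1 * x)%g) = limit_mean f.
Proof.
move=> bf; have /bounded_fun_exP[B fB] := bf.
have bgf : bounded_fun (fun x => f (g^-1 * x)%g).
  by apply/bounded_fun_exP; exists B => x; exact: fB.
have B0 : 0 <= B by exact: le_trans (fB 1%g).
set L' := limit_mean _; set L := limit_mean f.
apply/eqP; rewrite -subr_eq0 -normr_le0; apply/ler_addgt0Pl => e e0; rewrite addr0.
(* The Lipschitz estimate requires [d <= 1] and then yields an error of at most [e / 4], one of
   four; [B + 1] keeps the denominator positive when [B] is 0. *)
pose d := Num.min 1 (e / (12 * (B + 1))).
have B1 : 0 < 12 * (B + 1) by rewrite mulr_gt0// ltr_wpDl.
have d01 : 0 < d <= 1 by rewrite lt_min ltr01 divr_gt0//= ge_min lexx.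
have Bd : B * (3 * d) <= e / 4.
  have : d <= e / (12 * (B + 1)) by rewrite ge_min lexx orbT.
  rewrite ler_pdivlMr//; have /andP[d0 _] := d01; nra.
pose A := [set xi | `|L - sphere_sum f xi| < e / 4 /\
  `|L' - sphere_sum (fun x => f (g^-1 * x)%g) xi| < e / 4].
have UA : U A.
  have e4 : 0 < e / 4 by rewrite divr_gt0.
  have := cvg_limit_mean bf; move=> /cvgrPdist_lt/(_ _ e4) U1.
  have := cvg_limit_mean bgf; move=> /cvgrPdist_lt/(_ _ e4) U2.
  exact: filterI U1 U2.
have d0 : 0 < d by case/andP: d01.
have := Uconc UA (entourage_unit_sphere H d0)
  (fun i : 'I_2 => if i == ord0 then 1%g else g).
move=> [x xA].
have [x1 [z1 [z1f z1g] xz1] x1x] := xA ord0 I.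
have [x2 [z2 [z2f z2g] xz2] x2x] := xA ord_max I.
have close z y : rnorm (val z - val y) < d ->
    `|sphere_sum f z - sphere_sum f y| <= e / 4.
  move=> zy; apply: le_trans Bd; apply: (weighted_sum_lipschitz fB) => //.
    exact: sq_norm_unit_sphere.
  exact: ltW.
have x2E : x2 = act g^-1%g x by rewrite -x2x /= -sphere_actM mulVg sphere_act1.
have x1E : x1 = x by rewrite -x1x /= sphere_act1.
have c2 := close _ _ xz2.
have c1 : `|sphere_sum f (act g^-1%g z1) - sphere_sum f x2| <= e / 4.
  apply: close; rewrite x2E -x1E -linearB /rnorm urep_norm; exact: xz1.
move: c1; rewrite sphere_sum_act//.
move: c2 z1g z2f; rewrite !ler_norml !ltr_norml.
move=> /andP[a1 a2] /andP[b1 b2] /andP[c1 c1'] /andP[d1 d2].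
clear - a1 a2 b1 b2 c1 c1' d1 d2.
by apply/andP; split; lra.
Qed.

Lemma limit_mean_left_invariant : left_invariant_mean limit_mean.
Proof.
split.
- move=> a f h bf bh; apply: cvg_lim => //.
  rewrite (_ : sphere_sum _ = fun xi => a * sphere_sum f xi + sphere_sum h xi).
    apply: cvgD; last exact: cvg_limit_mean.
    by apply: cvgM; [exact: cvg_cst|exact: cvg_limit_mean].
  apply/funext => xi.
  move: bf bh => /bounded_fun_exP[B fB] /bounded_fun_exP[C hC].
  rewrite /sphere_sum /weighted_sum -rsum_lin; last 2 first.
  + exact: unconditional_weighted fB.
  + exact: unconditional_weighted hC.
  by congr rsum; apply/funext => p; ring.
- move=> f bf f0; apply: limr_ge; first by apply/cvg_ex; eexists; exact: cvg_limit_mean.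
  apply: filterE => xi; have /bounded_fun_exP[B fB] := bf.
  rewrite -[leLHS](@rsum0 R (G * nat)%type); apply: rsum_le.
  + exact: unconditional0.
  + exact: unconditional_weighted fB.
  by move=> p; rewrite mulr_ge0// nsq_ge0.
- apply: cvg_lim => //; rewrite (_ : sphere_sum _ = fun=> 1); first exact: cvg_cst.
  apply/funext => xi; rewrite -[RHS](sq_norm_unit_sphere xi).
  by congr rsum; apply/funext => p; rewrite mul1r.
- by move=> g f bf; exact: limit_mean_translate.
Qed.

End ConcentrationMean.

Theorem theorem2p6 (R : realType) (G : groupType) :
  amenable R G <->
  (forall (H : hilbertSpace R) (pi : unitary_rep G H),
     infinite_dimensional H -> concentration_property (sphere_action pi)).
Proof.
split=> [amG H pi infH|conc]; first exact: amenable_concentration.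
have [U UU Uconc] := exists_concentrated_ultrafilter
  (conc _ (translation_rep R G) (@ell2_infinite_dimensional R G)).
by eexists; exact: limit_mean_left_invariant Uconc.
Qed.
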